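(* Let $k$ be a positive integer, let $R=\mathbb{C}[x,y,z]$ and $\mathfrak{m}=(x,y,z)$. Then the Briançon–Iarrobino Conjecture holds in three dimensions: the most singular point of $\mathrm{Hilb}^{\binom{k+2}{3}}(\mathbb{A}^3)$ corresponds to the ideal $\mathfrak{m}^k$; that is, $[\mathfrak{m}^k]$ is the unique point of maximum singularity in $\mathrm{Hilb}^{\binom{k+2}{3}}(\mathbb{A}^3)$.
   Context: $\mathrm{Hilb}^l(\mathbb{A}^3)$ is the Hilbert scheme of points parametrising zero-dimensional closed subschemes of degree $l$ of $\mathbb{A}^3$; its closed points $[J]$ correspond to ideals $J\subset R=\mathbb{C}[x,y,z]$ of degree $l$, where the degree of a zero-dimensional ideal $J$ is $\dim_{\mathbb{C}}R/J$. The singularity of a point $[J]$ is measured by the dimension of the tangent space to the Hilbert scheme at $[J]$, namely $T(J)=\dim_{\mathbb{C}}\mathrm{Hom}_R(J,R/J)$; a point of maximum singularity (a most singular point) of $\mathrm{Hilb}^l(\mathbb{A}^3)$ is a point $[J]$ at which $T(J)$ attains its maximum over all points of $\mathrm{Hilb}^l(\mathbb{A}^3)$.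
   Formalization: Uniqueness is proved up to translation: every most singular point is the k-th power of the maximal ideal of some point p of A^3; literal uniqueness of [m^k] fails, since translating A^3 preserves T (for k=1 all points of A^3 are equally singular). *)

(* Defs.v *)
(* The field of complex numbers is R[i], over an arbitrary R : realType. *)
From HB Require Import structures.
From mathcomp Require Import all_boot all_order all_algebra.
From mathcomp Require Import boolp classical_sets functions reals.
From mathcomp Require Import complex.
From mathcomp Require Import mpoly.

Set Implicit Arguments.
Unset Strict Implicit.
Unset Printing Implicit Defensive.

Import GRing.Theory.
Local Open Scope ring_scope.
Local Open Scope quotient_scope.

Section Submodules.
Variables (A : nzRingType) (V : lmodType A).

(* Boolean predicates are no restriction: membership in an arbitrary submodule
   is made boolean by the classical `[< _ >]. *)
Record submodule := Submodule {
  submodule_pred :> {pred V};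
  submoduleP : submod_closed submodule_pred }.

HB.instance Definition _ (U : submodule) :=
  GRing.isSubmodClosed.Build A V (submodule_pred U) (submoduleP U).

Variable U : submodule.

Record submod := Submod { submod_val :> V; submod_valP : submod_val \in U }.

HB.instance Definition _ := [isSub for submod_val].
HB.instance Definition _ := [Choice of submod by <:].
HB.instance Definition _ := [SubChoice_isSubLmodule of submod by <:].

(* V / U: despite its notation, the library's {ideal_quot _} is the quotient of
   a zmodType by any additive subgroup; the scaling is added here. *)
Definition quotmod := {ideal_quot (submodule_pred U)}.

HB.instance Definition _ := GRing.Zmodule.on quotmod.

Local Notation pi := (\pi_{ideal_quot (submodule_pred U)}).

Definition quot_scale (a : A) (x : quotmod) : quotmod := pi (a *: repr x).

Lemma pi_scale a v : pi (a *: v) = quot_scale a (pi v).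
Proof.
apply/eqP; rewrite /quot_scale -Quotient.idealrBE -scalerBr rpredZ //.
by rewrite Quotient.idealrBE reprK.
Qed.

Fact quot_scalerA a b x :
  quot_scale a (quot_scale b x) = quot_scale (a * b) x.
Proof.
elim/quotW: x => x.
by rewrite -(pi_scale b x) -(pi_scale a) -(pi_scale _ x) scalerA.
Qed.

Fact quot_scale1r : left_id 1 quot_scale.
Proof. by elim/quotW=> x; rewrite -(pi_scale 1 x) scale1r. Qed.

Fact quot_scalerDr : right_distributive quot_scale +%R.
Proof.
move=> a; elim/quotW=> x; elim/quotW=> y; rewrite -raddfD.
by rewrite -(pi_scale a x) -(pi_scale a y) -(pi_scale a) scalerDr raddfD.
Qed.

Fact quot_scalerDl x : {morph quot_scale^~ x : a b / a + b}.
Proof.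
by elim/quotW: x => x a b; rewrite -!(pi_scale _ x) scalerDl raddfD.
Qed.

HB.instance Definition _ := GRing.Zmodule_isLmodule.Build A quotmod
  quot_scalerA quot_scale1r quot_scalerDr quot_scalerDl.

End Submodules.

Section Hom.
Variables (A : comNzRingType) (M N : lmodType A).

Definition is_hom : {pred M -> N} := fun f => `[< linear f >].

Fact is_hom_closed : submod_closed is_hom.
Proof.
split=> [|a f g /asboolP hf /asboolP hg]; apply/asboolP => b x y.
  by rewrite /= scaler0 addr0.
have E z : (a *: f + g) z = a *: f z + g z by [].
by rewrite !E hf hg !scalerDr !scalerA (mulrC b) addrACA.
Qed.

Definition hom : lmodType A := submod (Submodule is_hom_closed).

End Hom.

Section RestrictionOfScalars.
Variables (K : comNzRingType) (A : algType K) (M : lmodType A).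

Definition restr : Type := M.

HB.instance Definition _ := GRing.Zmodule.on restr.

Definition restr_scale (c : K) (x : restr) : restr := (c%:A : A) *: (x : M).

Fact restr_scalerA c d x :
  restr_scale c (restr_scale d x) = restr_scale (c * d) x.
Proof. by rewrite /restr_scale scalerA mulr_algl scalerA. Qed.

Fact restr_scale1r : left_id 1 restr_scale.
Proof. by move=> x; rewrite /restr_scale scale1r [LHS]scale1r. Qed.

Fact restr_scalerDr : right_distributive restr_scale +%R.
Proof. by move=> c x y; rewrite /restr_scale -scalerDr. Qed.

Fact restr_scalerDl x : {morph restr_scale^~ x : c d / c + d}.
Proof. by move=> c d; rewrite /restr_scale scalerDl [LHS]scalerDl. Qed.

HB.instance Definition _ := GRing.Zmodule_isLmodule.Build K restr
  restr_scalerA restr_scale1r restr_scalerDr restr_scalerDl.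

End RestrictionOfScalars.

Arguments restr K {A} M.

(* A relation rather than a function, since V need not be finite-dimensional a
   priori; Vector.axiom n V is the data of a linear bijection V -> 'rV[K]_n. *)
Definition is_dim (K : fieldType) (V : lmodType K) (n : nat) : Prop :=
  inhabited (Vector.axiom n V).

Section Ideals.
Variable A : comNzRingType.

(* Unlike the library's idealr, this includes the unit ideal. *)
Definition ideal := submodule A^o.

Definition gen_pred (S : set A) : {pred A^o} := fun f =>
  `[< forall J : ideal, (forall s, S s -> s \in J) -> f \in J >].

Fact gen_closed S : submod_closed (gen_pred S).
Proof.
split=> [|a f g /asboolP hf /asboolP hg]; apply/asboolP => J hJ.
  exact: rpred0.
by rewrite rpredD ?rpredZ ?hf ?hg.
Qed.

Definition gen (S : set A) : ideal := Submodule (gen_closed S).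

Definition ideal_mul (I J : ideal) : ideal :=
  gen [set h | exists f g : A, [/\ f \in I, g \in J & h = f * g]].

Definition ideal_exp (I : ideal) (k : nat) : ideal :=
  iter k (ideal_mul I) (gen [set 1]).

End Ideals.

Section PointIdeals.
Variables (K : comNzRingType) (n : nat).

Definition origin_ideal : ideal {mpoly K[n]} :=
  gen [set f | exists i : 'I_n, f = 'X_i].

Definition point_ideal (p : 'I_n -> K) : ideal {mpoly K[n]} :=
  gen [set f | exists i : 'I_n, f = 'X_i - (p i)%:MP].

End PointIdeals.

Section HilbertScheme.
Variable R : realType.

Local Notation C := R[i].
Local Notation P := {mpoly C[3]}.

(* [J] is a closed point of Hilb^l(A^3). *)
Definition has_degree (J : ideal P) (l : nat) : Prop :=
  is_dim (restr C (quotmod J)) l.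

(* T(J) = t *)
Definition has_tangent_dim (J : ideal P) (t : nat) : Prop :=
  is_dim (restr C (hom (submod J) (quotmod J))) t.

(* Every competitor J' is required to have a tangent dimension t', so that the
   maximality clause cannot hold vacuously. *)
Definition most_singular (l : nat) (J : ideal P) : Prop :=
  has_degree J l /\
  exists2 t, has_tangent_dim J t &
    forall J' : ideal P, has_degree J' l ->
      exists2 t', has_tangent_dim J' t' & (t' <= t)%N.

End HilbertScheme.

(* Main.v *)
(* Let A = R/J with dim A = l, and let X, Y, Z be the commuting multiplication
   operators on A.  First order deformations of J are, modulo conjugation, first
   order deformations of the triple (X, Y, Z), so T(J) <= dim T_(X,Y,Z) - (l^2 - l)
   for the tangent space T_(X,Y,Z) of the commuting scheme.  This space is the
   kernel of the Hessian of tr X[Y,Z], a symmetric form.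

   Splitting A along eigenvalues reduces to X, Y, Z nilpotent.  Filter A by
   F_j = z^j A, where z = Z + aX + bY has powers of maximal rank.  The
   deformations (X', Y', Z') that preserve the filtration, Z' raising it by one,
   form an isotropic subspace of the Hessian; comparing it with its orthogonal
   gives T(J) <= sum_j a_j (2 s_j + 1), where a_j = dim F_j / F_(j+1) and s_j is
   the dimension of the socle of the C[x,y]-module F_j / F_(j+1).  This module is
   cyclic, hence a_j >= s_j (s_j + 1) / 2, and genericity of z gives
   a_j - a_(j+1) <= s_j.  Under these constraints the sum is at most a convex
   function of l with value T(m^k) at l = C(k+2,3).  Equality forces z^k = 0,
   then h^k = 0 for every linear form h by maximality of the ranks, hence m^k = 0
   in A by polarization. *)
Require Import Defs.
From HB Require Import structures.
From mathcomp Require Import all_boot all_order all_algebra.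
From mathcomp Require Import boolp classical_sets functions reals.
From mathcomp Require Import complex.
From mathcomp Require Import mpoly.
From mathcomp Require Import zify.
From mathcomp Require Import ring.

Set Implicit Arguments.
Unset Strict Implicit.
Unset Printing Implicit Defensive.

(** * Extremal sequences of slices *)

(** Operators act on the right of row vectors and a subspace is the row space of a matrix, so z^j A
    is the row space of [Z ^+ j]. Origin of 2 s_j + 1: compared with the deformations preserving the
    filtration, their orthogonal gains at most a_j s_j dimensions at level j, from maps of F_j ∩ ker
    z detected on the socle of F_j / F_(j+1). The isotropy argument doubles this gain, the other
    contributions add up to l^2, and the last 1 comes from sum_j a_j = l. The obstacle is that the
    estimate for cyclic modules is too weak alone: a single slice with a_0 = l and s_0 about
    sqrt(2l) gives a sum of order l^(3/2), while T(m^k) has order l^(4/3). Genericity of z excludes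
    such profiles, since it makes the slices shrink slowly. For m^k and j < k one has s_j = k - j
    and a_j = C(k - j + 1, 2), and all these inequalities are equalities. *)

Definition tri m := 'C(m.+1, 2).
Definition tet k := 'C(k.+2, 3).

Lemma triS m : tri m.+1 = m.+1 + tri m.
Proof. by rewrite /tri binS bin1 addnC. Qed.

Lemma tetS k : tet k.+1 = tri k.+1 + tet k.
Proof. by rewrite /tet binS addnC. Qed.

Lemma tri_mono : {homo tri : m n / m <= n}.
Proof. by move=> m n le_mn; rewrite /tri leq_bin2l. Qed.

Lemma tet_mono : {homo tet : m n / m <= n}.
Proof. by move=> m n le_mn; rewrite /tet leq_bin2l. Qed.

Lemma leq_tet m : m <= tet m.
Proof. by elim: m => // m IHm; rewrite tetS triS; lia. Qed.

(* [kappa n] is the [s] with [tet s.-1 <= n < tet s]. *)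
Definition kappa n := \sum_(m < n.+1) (tet m <= n).

(* Convex and piecewise linear in [n]; at [n = tet k] it is the tangent dimension
   of the [k]-th power of a maximal ideal. *)
Definition maxT n := \sum_(i < n) (2 * kappa i).+1.

Lemma kappa_ge m n : tet m <= n -> m < kappa n.
Proof.
move=> le_mn; rewrite /kappa.
have lt_mn : m < n.+1 by apply: leq_trans (leq_tet m) _.
rewrite -[X in X <= _](card_ord m.+1) -sum1_card.
rewrite (big_ord_widen n.+1 (fun=> 1)) //.
rewrite big_mkcond /= leq_sum // => i _; case: ifP => // lt_im.
by rewrite (leq_trans _ le_mn) // tet_mono.
Qed.

Lemma kappa_le n k : n < tet k -> kappa n <= k.
Proof.
move=> lt_nk; rewrite /kappa.
have sum_lt N : \sum_(i < N) (i < k) = minn N k.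
  elim: N => [|N IHN]; first by rewrite big_ord0 min0n.
  by rewrite big_ord_recr /= IHN; lia.
apply: (leq_trans _ (geq_minr n.+1 k)); rewrite -sum_lt leq_sum // => i _.
case: (leqP (tet i) n) => // le_in; case: (ltnP i k) => // /tet_mono le_ki.
by have := leq_trans le_ki le_in; rewrite leqNgt lt_nk.
Qed.

Lemma kappa_mono : {homo kappa : m n / m <= n}.
Proof.
move=> m n le_mn; rewrite /kappa (big_ord_widen n.+1 (fun i => (tet i <= m) : nat)) //.
rewrite big_mkcond leq_sum // => i _; case: ifP => // _.
by case: (leqP (tet i) m) => // le_im; rewrite (leq_trans le_im).
Qed.

Lemma maxTD m n : maxT (m + n) = maxT m + \sum_(i < n) (2 * kappa (m + i)).+1.
Proof. by rewrite /maxT big_split_ord. Qed.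

(** Convexity: once [l] has reached [tet s.-1], every further increment of [maxT] is at least
    [(2 * s).+1]. *)
Lemma maxT_ge l n s : (s = 0) \/ (tet s.-1 <= l) ->
  maxT l + n * (2 * s).+1 <= maxT (l + n).
Proof.
move=> hs; rewrite maxTD leq_add2l.
rewrite -[X in X * _]card_ord -sum_nat_const leq_sum // => i _.
case: hs => [->|hs]; first by rewrite muln0.
have : s.-1 < kappa (l + i) by apply: kappa_ge; lia.
lia.
Qed.

(** Strictness comes from the first increment: [kappa 0] is at most 1, whereas [kappa m] is at least
    2 for positive [m]. It excludes several points of support in the extremal case. *)
Lemma maxT_superadd m n : 0 < m -> 0 < n -> maxT m + maxT n < maxT (m + n).
Proof.
move=> m_gt0; case: n => // n _; rewrite maxTD ltn_add2l /maxT !big_ord_recl.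
rewrite -addSn leq_add //.
  have k0 : kappa 0 <= 1 by rewrite kappa_le.
  have k1 : 1 < kappa m by rewrite kappa_ge.
  by rewrite /= addn0; lia.
rewrite leq_sum // => i _.
by rewrite ltnS leq_mul // kappa_mono //; exact: leq_addl.
Qed.

(** For positive [k] the right-hand side is the dimension of the space of linear maps from forms of
    degree k to forms of degree k - 1 in three variables. *)
Lemma maxT_tet k : maxT (tet k) = 'C(k.+2, 2) * 'C(k.+1, 2).
Proof.
elim: k => [|k IHk]; first by rewrite /maxT big_ord0.
rewrite tetS addnC maxTD IHk.
rewrite (eq_bigr (fun=> (2 * k.+1).+1)) => [|i _]; last first.
  congr (_ * _).+1; apply/eqP; rewrite eqn_leq kappa_le ?kappa_ge ?leq_addr //.
  by rewrite tetS addnC ltn_add2r.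
rewrite sum_nat_const card_ord /tri.
rewrite !(binS _ 1) !bin1.
have := bin2 k; have : ('C(k, 2)).*2 = k * k.-1 by rewrite bin2 halfK oddM; case: k {IHk} => //= k; rewrite andNb subn0.
move: ('C(k, 2)) => c; case: k {IHk} => [|k] /=; nia.
Qed.

(* Below, [a j], [s j] and [L j] are the dimensions of z^jA / z^(j+1)A, of its
   socle, and of z^jA. *)
Section Profile.
Variables (a s L : nat -> nat) (n : nat).
Hypothesis tri_s : forall j, tri (s j) <= a j.
Hypothesis drop_a : forall j, a j <= a j.+1 + s j.
Hypothesis decr_a : forall j, a j.+1 <= a j.
Hypothesis LE : forall j, L j = a j + L j.+1.
Hypothesis Ln : L n = 0.

(** If [s j <= m], the drop from [tri m] is at most [m]. If [s j > m], then [tri_s] already gives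
    [a j.+1 >= tri (s j) - s j = tri (s j).-1]. *)
Lemma tri_next m j : tri m <= a j -> tri m.-1 <= a j.+1.
Proof.
case: m => [|m] le_m; first by rewrite (leq_trans _ (leq0n _)).
have := drop_a j; have := tri_s j; move: le_m; rewrite triS /=.
case: (leqP (s j) m.+1) => [|lt_ms]; first by lia.
have /tri_mono : m <= (s j).-1 by lia.
case: (s j) lt_ms => // s' _; rewrite triS /=; lia.
Qed.

Lemma tet_le m j : tri m <= a j -> tet m <= L j.
Proof.
elim: m j => [|m IHm] j le_m; first by [].
by rewrite LE tetS leq_add // IHm // (tri_next le_m).
Qed.

Lemma tet_pred_le j : s j = 0 \/ tet (s j).-1 <= L j.+1.
Proof. by right; apply/tet_le/tri_next. Qed.

Definition weight j m := \sum_(j <= i < j + m) a i * (2 * s i).+1.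

Lemma weightS j m : weight j m.+1 = a j * (2 * s j).+1 + weight j.+1 m.
Proof. by rewrite /weight big_ltn ?addSnnS //; lia. Qed.

(** Slices are added from the last to the first: by [tet_pred_le], the mass [L j.+1] beyond slice
    [j] is already in the range where [maxT] has slope at least [(2 * s j).+1]. *)
Lemma weight_le m j : weight j m <= maxT (L j).
Proof.
elim: m j => [|m IHm] j; first by rewrite /weight addn0 big_geq.
rewrite weightS LE [a j + L _]addnC.
apply: leq_trans (maxT_ge (a j) (tet_pred_le j)).
by rewrite addnC leq_add2r.
Qed.

Lemma a0_L0 j : a j = 0 -> L j = 0.
Proof.
move=> aj0; have ai0 i : a (j + i) = 0.
  by elim: i => [|i IHi]; rewrite ?addn0 // addnS; have := decr_a (j + i); lia.
have Li i : L j = L (j + i).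
  by elim: i => [|i IHi]; rewrite ?addn0 // IHi (LE (j + i)) ai0 addnS.
have LN i : L (n + i) = 0.
  by elim: i => [|i IHi]; rewrite ?addn0 ?Ln // addnS; have := LE (n + i); lia.
by rewrite (Li n) addnC LN.
Qed.

(** For [L j = tet k.+1] the last increment of [maxT] is [(2 * k.+1).+1], so equality forces
    [s j >= k.+1]; a larger [s j] would contradict [tet_pred_le]. Then [a j] and [L j.+1] are at
    least [tri k.+1] and [tet k], whose sum is [L j], and the induction goes on with
    [L j.+1 = tet k]. *)
Lemma weight_eq m k j : L j = tet k -> weight j m = maxT (L j) -> L (j + k) = 0.
Proof.
elim: k j m => [|k IHk] j m; first by rewrite addn0.
move=> Lj wj.
have aj_gt0 : 0 < a j.
  rewrite lt0n; apply/eqP => /a0_L0; rewrite Lj tetS triS; lia.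
case: m wj => [|m] wj.
  have : 0 < maxT (L j).
    rewrite Lj maxT_tet muln_gt0 !bin_gt0; lia.
  by rewrite -wj /weight addn0 big_geq.
have := wj; rewrite weightS LE [a j + L _]addnC => wj'.
have le1 := maxT_ge (a j) (tet_pred_le j).
have le2 := weight_le m j.+1.
have weq : weight j.+1 m = maxT (L j.+1) by lia.
suff sj : s j = k.+1.
  rewrite addnS -addSn (IHk _ m) //.
  have := tri_s j; have := tet_pred_le j; rewrite sj /=.
  have := LE j; rewrite Lj tetS; lia.
have e : maxT (L j.+1 + a j) = maxT (L j.+1) + a j * (2 * s j).+1 by lia.
move: e; rewrite maxTD => /addnI.
have aE : a j = (a j).-1.+1 by lia.
rewrite aE big_ord_recr /= -aE.
have := maxT_ge (a j).-1 (tet_pred_le j); rewrite maxTD leq_add2l => le3.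
have -> : kappa (L j.+1 + (a j).-1) = k.+1.
  have LL := LE j; rewrite Lj tetS triS in LL.
  apply/eqP; rewrite eqn_leq kappa_le ?kappa_ge //; first by lia.
  by rewrite tetS triS; lia.
move=> e.
have lo : s j <= k.+1.
  rewrite leqNgt; apply/negP => lt.
  case: (tet_pred_le j) => [|h]; first by lia.
  have := LE j; rewrite Lj; have /tet_mono : k.+1 <= (s j).-1 by lia.
  lia.
move: le3 e; clear aE wj' le1; case: (a j) aj_gt0 => //= p _.
rewrite [p.+1 * _]mulSn.
move: (\sum_(_ < _) _) (p * _) => S1 S2; lia.
Qed.

End Profile.

Import Order.TTheory GRing.Theory Num.Theory.
Local Open Scope ring_scope.

(** * Dimension counts *)

Section Subspaces.
Variables (F : fieldType) (V : vectType F).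

(** A subspace of largest dimension inside [P] cannot be enlarged by the line of a vector satisfying
    [P]. This turns linear conditions on triples into subspaces that have a dimension. *)
Lemma pred_vspace (P : V -> Prop) :
  P 0 -> (forall a u v, P u -> P v -> P (a *: u + v)) ->
  exists U : {vspace V}, forall v, v \in U <-> P v.
Proof.
move=> P0 Plin.
pose D d := `[< exists2 U : {vspace V}, forall v, v \in U -> P v & \dim U = d >].
have exD : exists d, D d.
  exists 0%N; apply/asboolP; exists 0%VS; rewrite ?dimv0 // => v.
  by rewrite memv0 => /eqP ->.
have leD d : D d -> (d <= \dim {:V})%N.
  by move=> /asboolP [U _ <-]; rewrite dimvS ?subvf.
case: (ex_maxnP exD leD) => d /asboolP [U UP dimU] maxd.
exists U => v; split=> [/UP //|Pv].
suff -> : U = (U + <[v]>)%VS.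
  by apply: (subvP (addvSr U _)); apply: memv_line.
apply/eqP; rewrite eqEdim addvSl /= dimU maxd //.
apply/asboolP; exists (U + <[v]>)%VS => // w /memv_addP [u Uu [_ /vlineP [a ->] ->]].
by rewrite addrC; apply: Plin => //; apply: UP.
Qed.

Lemma dim_ker_image_le (W : vectType F) (f : V -> W) (U U' : {vspace V}) (B : {vspace W}) :
  linear f -> (forall u, u \in U -> f u \in B) ->
  (forall u, u \in U -> f u = 0 -> u \in U') -> (\dim U <= \dim U' + \dim B)%N.
Proof.
move=> linf fB fU.
pose lf := GRing.isLinear.Build F V W _ f linf.
pose g : {linear V -> W} := HB.pack f lf.
rewrite -(limg_ker_dim (linfun g) U) leq_add // dimvS //.
  apply/subvP => u; rewrite memv_cap memv_ker lfunE /= => /andP [Uu /eqP].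
  exact: fU.
by apply/subvP => w /memv_imgP [u Uu ->]; rewrite lfunE /= fB.
Qed.

Lemma dim_ker_le (W : vectType F) (f : V -> W) (U U' : {vspace V}) :
  linear f -> (forall u, u \in U -> f u = 0 -> u \in U') ->
  (\dim U <= \dim U' + dim W)%N.
Proof.
move=> linf fU; rewrite -dimvf; apply: (dim_ker_image_le linf) => // u _.
exact: memvf.
Qed.

Lemma dim_inj_le (W : vectType F) (f : V -> W) (U : {vspace V}) (B : {vspace W}) :
  linear f -> (forall u, u \in U -> f u = 0 -> u = 0) ->
  (forall u, u \in U -> f u \in B) -> (\dim U <= \dim B)%N.
Proof.
move=> linf finj fB; have := @dim_ker_image_le W f U 0%VS B linf fB.
by rewrite dimv0 add0n; apply=> u Uu fu; rewrite (finj u Uu fu) mem0v.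
Qed.

End Subspaces.

Section Matrices.
Variable F : fieldType.

(** [P] gives coordinates on the quotient of [U] by [V], with as many columns as its dimension. *)
Lemma quot_coord n (U V : 'M[F]_n) : (V <= U)%MS ->
  exists P : 'M[F]_(n, \rank U - \rank V),
    forall m (u : 'M_(m, n)), (u <= U)%MS -> (u *m P == 0) = (u <= V)%MS.
Proof.
move=> sVU; pose B := U *m cokermx V.
have rB : \rank B = (\rank U - \rank V)%N.
  rewrite -(mxrank_mul_ker U (cokermx V)) -/B.
  suff -> : \rank (U :&: kermx (cokermx V)) = \rank V by rewrite addnK.
  apply/eqmx_rank/andP; split; last first.
    by rewrite sub_capmx sVU sub_kermx mulmx_coker eqxx.
  apply/rV_subP => u; rewrite sub_capmx sub_kermx => /andP [_ /eqP uV].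
  by rewrite submxE uV.
rewrite -rB.
have /row_freeP [G BG] := row_base_free B.
exists (cokermx V *m G) => m u /submxP [c ->].
rewrite -mulmxA [U *m _]mulmxA -/B mulmxA submxE -[in RHS]mulmxA -/B.
have /submxP [c' ->] : (c *m B <= row_base B)%MS by rewrite eq_row_base submxMl.
by rewrite -mulmxA BG mulmx1 mulmx_free_eq0 ?row_base_free.
Qed.

(** [q] is a minor in adapted bases: [B] and [C] are chosen so that [C *m M *m B] is the identity at
    [t0], and where its determinant is nonzero [M] has at least that rank. *)
Lemma rank_semicont m n (M : 'M[{poly F}]_(m, n)) t0 :
  exists2 q : {poly F}, q.[t0] != 0 & forall t, q.[t] != 0 ->
    (\rank (map_mx (horner^~ t0) M) <= \rank (map_mx (horner^~ t) M))%N.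
Proof.
set A := map_mx _ M.
have /row_freeP [B AB] := row_base_free A.
have /row_fullP [C CA] := col_base_full A.
pose q := \det (map_mx polyC C *m M *m map_mx polyC B).
have qE t : q.[t] = \det (C *m map_mx (horner^~ t) M *m B).
  rewrite -[q.[t]]/(horner_eval t q) -det_map_mx !map_mxM -!map_mx_comp.
  congr (\det (_ *m _ *m _)); apply/matrixP=> i j; rewrite !mxE /= /horner_eval ?hornerC //.
exists q => [|t].
  have CAB : C *m A *m B = 1%:M.
    transitivity (C *m (col_base A *m row_base A) *m B); first by rewrite mulmx_base.
    by rewrite mulmxA CA mul1mx.
  by rewrite qE -/A CAB det1 oner_neq0.
rewrite qE -unitfE -unitmxE -row_free_unit -row_leq_rank => /leq_trans; apply.
by rewrite (leq_trans (mxrankM_maxl _ _)) // mxrankM_maxr.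
Qed.

End Matrices.

(* Abstracting the ranks keeps [lia] from traversing the matrices. *)
Ltac rank_lia :=
  intros;
  repeat match goal with
  | H : ?P |- _ =>
      lazymatch P with
      | is_true (leq _ _) => revert H
      | @eq ?T ?a ?b => unify T nat; change (@eq nat a b) in H; revert H
      | or _ _ => revert H
      end
  end;
  repeat match goal with
  | |- context [@mxrank ?F ?m ?n ?A] => generalize (@mxrank F m n A); intro
  end;
  repeat match goal with
  | H : ?P |- _ => tryif unify P nat then fail else clear H
  end; intros; lia.

Section Rank.
Variable F : fieldType.

Lemma rank_coker m p n (A : 'M[F]_(m, n)) (B : 'M_(p, n)) :
  (\rank (A *m cokermx B) + \rank B)%N = \rank (A + B)%MS.
Proof.
have := mxrank_mul_ker A (cokermx B); have := mxrank_sum_cap A B.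
suff -> : \rank (A :&: kermx (cokermx B))%MS = \rank (A :&: B)%MS by rank_lia.
apply/eqmx_rank/andP; split; rewrite sub_capmx capmxSl /=; last first.
  apply: submx_trans (capmxSr _ _) _.
  by rewrite sub_kermx mulmx_coker.
apply: submx_trans (capmxSr _ _) _.
by rewrite submxE mulmx_ker.
Qed.

(** [T] induces a map from [U] onto the quotient of [U *m T + W] by [W], whose kernel contains
    [K]. *)
Lemma rank_ker_coker n m (T W : 'M[F]_n) (U : 'M_(m, n)) (K : 'M_n) :
  (K <= U)%MS -> (K *m T <= W)%MS ->
  (\rank K + \rank (U *m T + W)%MS <= \rank U + \rank W)%N.
Proof.
move=> sKU sKW; rewrite -rank_coker -mulmxA -(mxrank_mul_ker U (T *m cokermx W)).
have : (K <= U :&: kermx (T *m cokermx W))%MS.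
  by rewrite sub_capmx sKU sub_kermx mulmxA -submxE.
by move=> /mxrankS; rank_lia.
Qed.

Lemma expmxS (K : pzSemiRingType) n (A : 'M[K]_n) k : A ^+ k.+1 = A *m A ^+ k.
Proof. by rewrite exprS. Qed.

Lemma expmxSr (K : pzSemiRingType) n (A : 'M[K]_n) k : A ^+ k.+1 = A ^+ k *m A.
Proof. by rewrite exprSr. Qed.

Lemma comm_expmx n (A B : 'M[F]_n) k : A *m B = B *m A -> A ^+ k *m B = B *m A ^+ k.
Proof.
move=> cAB; elim: k => [|k IHk]; first by rewrite expr0 mul1mx mulmx1.
by rewrite expmxS -mulmxA IHk mulmxA cAB -mulmxA.
Qed.

Lemma expmxZ n c (A : 'M[F]_n) k : (c *: A) ^+ k = c ^+ k *: A ^+ k.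
Proof.
elim: k => [|k IHk]; first by rewrite !expr0 scale1r.
by rewrite !expmxS IHk -scalemxAl -scalemxAr scalerA -exprS.
Qed.

Lemma expmx_nil n (A : 'M[F]_n) k l : A ^+ k = 0 -> (k <= l)%N -> A ^+ l = 0.
Proof. by move=> Ak le_kl; rewrite -(subnK le_kl) exprD Ak mulr0. Qed.

End Rank.

(** * Socles of cyclic modules over a polynomial ring in two variables *)

Section Planar.
Variables (F : fieldType) (n : nat) (X Y U V : 'M[F]_n) (g : 'rV[F]_n) (N : nat).
Hypothesis XY : X *m Y = Y *m X.
Hypothesis sVU : (V <= U)%MS.
Hypotheses (UX : (U *m X <= U)%MS) (UY : (U *m Y <= U)%MS).
Hypotheses (VX : (V *m X <= V)%MS) (VY : (V *m Y <= V)%MS).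
Hypothesis sgU : (g <= U)%MS.
Hypothesis genU : forall W : 'M[F]_n, (V <= W)%MS -> (g <= W)%MS ->
  (W *m X <= W)%MS -> (W *m Y <= W)%MS -> (U <= W)%MS.
Hypothesis nilX : X ^+ N = 0.
Variable S : 'M[F]_n.
Hypotheses (sSU : (S <= U)%MS) (sVS : (V <= S)%MS).
Hypotheses (SX : (S *m X <= V)%MS) (SY : (S *m Y <= V)%MS).

Let Us i : 'M[F]_n := (V + U *m X ^+ i)%MS.
Let Ss i : 'M[F]_n := (S :&: Us i)%MS.

Let sUsS i : (Us i.+1 <= Us i)%MS.
Proof.
rewrite /Us addsmx_sub addsmxSl /= expmxS mulmxA.
by apply: submx_trans (submxMr _ UX) (addsmxSr _ _).
Qed.

Let UsX i : (Us i *m X <= Us i.+1)%MS.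
Proof.
rewrite /Us addsmxMr addsmx_sub (submx_trans VX) ?addsmxSl //=.
by rewrite -mulmxA -expmxSr addsmxSr.
Qed.

Let UsSE i : (Us i.+1 <= Us i *m X + Us i.+2)%MS.
Proof.
rewrite {1}/Us addsmx_sub; apply/andP; split.
  by apply: submx_trans (addsmxSr _ _); rewrite addsmxSl.
rewrite expmxSr mulmxA; apply: submx_trans (addsmxSl _ _).
by rewrite submxMr // addsmxSr.
Qed.

(** The vectors of [U] that [X ^+ i] sends into the right-hand side form a submodule containing [V]
    and [g], hence all of [U]. So slice [i], the quotient of [Us i] by [Us i.+1], is cyclic over
    F[Y]. *)
Let UsYg i : (Us i <= Us i *m Y + Us i.+1 + g *m X ^+ i)%MS.
Proof.
set R := (_ + g *m _)%MS.
have sVR : (V <= R)%MS.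
  by apply: submx_trans (addsmxSl _ _); apply: submx_trans (addsmxSr _ _); rewrite addsmxSl.
rewrite {1}/Us addsmx_sub sVR /=.
have key (W : 'M[F]_n) : (W <= U :&: kermx (X ^+ i *m cokermx R))%MS =
  (W <= U)%MS && (W *m X ^+ i <= R)%MS.
  by rewrite sub_capmx sub_kermx mulmxA -submxE.
have sUK : (U <= U :&: kermx (X ^+ i *m cokermx R))%MS.
  set K := (_ :&: _)%MS.
  have /andP [sKU KR] : (K <= U)%MS && (K *m X ^+ i <= R)%MS by rewrite -key.
  apply: genU; rewrite sub_capmx.
  - rewrite sVU sub_kermx mulmxA -submxE.
    apply: submx_trans sVR; elim: i {R key K sKU KR} => [|i IHi].
      by rewrite expr0 mulmx1.
    by rewrite expmxSr mulmxA (submx_trans (submxMr _ IHi)).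
  - by rewrite sgU sub_kermx mulmxA -submxE addsmxSr.
  - rewrite (submx_trans (submxMr _ sKU)) // sub_kermx mulmxA -submxE.
    apply: submx_trans (addsmxSl _ _); apply: submx_trans (addsmxSr _ _).
    apply: submx_trans (addsmxSr _ _).
    by rewrite -mulmxA -expmxS submxMr.
  - rewrite (submx_trans (submxMr _ sKU)) // sub_kermx mulmxA -submxE.
    apply: submx_trans (addsmxSl _ _); apply: submx_trans (addsmxSl _ _).
    rewrite -mulmxA -comm_expmx // mulmxA submxMr //.
    by apply: submx_trans (addsmxSr _ _); rewrite submxMr.
by move: sUK; rewrite key => /andP [].
Qed.

Let rankK i : \rank (Us i.+1 + Ss i)%MS =
  (\rank (Us i.+1) + \rank (Ss i) - \rank (Ss i.+1))%N.
Proof.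
have := mxrank_sum_cap (Us i.+1) (Ss i).
suff -> : \rank (Us i.+1 :&: Ss i)%MS = \rank (Ss i.+1) by rank_lia.
apply/eqmx_rank/andP; split; rewrite !sub_capmx ?capmxSl ?capmxSr ?andbT /=.
  by apply: submx_trans (capmxSr _ _) (capmxSl _ _).
by apply: submx_trans (capmxSr _ _) (sUsS _).
Qed.

Let sSs i : (\rank (Ss i.+1) <= \rank (Ss i))%N.
Proof.
by rewrite mxrankS // capmxS.
Qed.

Let sK i : (Us i.+1 + Ss i <= Us i)%MS.
Proof. by rewrite addsmx_sub sUsS capmxSr. Qed.

(** Slice [i] is cyclic under [Y], so the cokernel of [Y] on it has dimension at most one, hence so
    has the kernel, which contains the socle part. *)
Let stepA i : (\rank (Ss i) <= (\rank (Ss i.+1)).+1)%N.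
Proof.
have h : ((Us i.+1 + Ss i)%MS *m Y <= Us i.+1)%MS.
  rewrite addsmxMr addsmx_sub; apply/andP; split.
    rewrite addsmxMr addsmx_sub (submx_trans VY) ?addsmxSl //=.
    rewrite -mulmxA comm_expmx // mulmxA.
    by apply: submx_trans (addsmxSr _ _); rewrite submxMr.
  apply: submx_trans (submxMr _ (capmxSl _ _)) _.
  by apply: submx_trans SY (addsmxSl _ _).
have := rank_ker_coker (sK i) h; rewrite rankK.
have := mxrankS (UsYg i); have := mxrank_adds_leqif (Us i *m Y + Us i.+1)%MS (g *m X ^+ i).
have := rank_leq_row (g *m X ^+ i); have := sSs i.
case=> ? + [+ _]; have := mxrankS (sUsS i); rank_lia.
Qed.

(** [X] maps slice [i] onto slice [i.+1] and kills the socle part of slice [i]. *)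
Let stepB i : (\rank (Us i.+1) - \rank (Us i.+2) + (\rank (Ss i) - \rank (Ss i.+1))
  <= \rank (Us i) - \rank (Us i.+1))%N.
Proof.
have h : ((Us i.+1 + Ss i)%MS *m X <= Us i.+2)%MS.
  rewrite addsmxMr addsmx_sub UsX /=.
  apply: submx_trans (submxMr _ (capmxSl _ _)) _.
  by apply: submx_trans SX (addsmxSl _ _).
have := rank_ker_coker (sK i) h; rewrite rankK.
have := mxrankS (UsSE i); have := sSs i.
have := mxrankS (sUsS i); have := mxrankS (sUsS i.+1); have := mxrankS (sK i); rewrite rankK.
rank_lia.
Qed.

(* In the filtration of U/V by the powers of X, the socle contributes at most one
   dimension to each slice, and only where the dimension of the slices drops. *)
Lemma planar_socle : (tri (\rank S - \rank V) <= \rank U - \rank V)%N.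
Proof.
have sVUs i : (\rank V <= \rank (Us i))%N by rewrite mxrankS // addsmxSl.
have sVSs i : (\rank V <= \rank (Ss i))%N by rewrite mxrankS // sub_capmx sVS addsmxSl.
(* Descending induction on [i]. When the socle part grows by one at [i], [stepB] makes slice [i]
   larger than slice [i.+1], so the second bound also goes up by one and supplies the new summand of
   [tri]. *)
have main m : forall i, (N <= i + m)%N ->
  (tri (\rank (Ss i) - \rank V) <= \rank (Us i) - \rank V)%N /\
  (\rank (Ss i) - \rank V <= \rank (Us i) - \rank (Us i.+1))%N.
  elim: m => [|m IHm] i le_N.
    suff : (\rank (Ss i) <= \rank V)%N.
      by rewrite -subn_eq0 => /eqP ->.
    rewrite mxrankS //; apply: submx_trans (capmxSr _ _) _.
    by rewrite addsmx_sub submx_refl (expmx_nil nilX) ?mulmx0 ?sub0mx // -(addn0 i).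
  have [|t1 t2] := IHm i.+1; first by rank_lia.
  have sA := stepA i; have sB := stepB i.
  have l1 := sVUs i.+1; have l2 := sVSs i.+1; have l3 := sVSs i.
  have l4 := mxrankS (sUsS i); have l5 := sSs i.
  split; last by rank_lia.
  have [e|e] : \rank (Ss i) = \rank (Ss i.+1) \/ \rank (Ss i) = (\rank (Ss i.+1)).+1 by rank_lia.
    by rewrite e; rank_lia.
  rewrite e subSn // triS; rank_lia.
have [] := main N 0%N; first by rewrite leq_addl.
have E0 : (Us 0%N == U)%MS.
  by apply/andP; split; rewrite /Us expr0 mulmx1 ?addsmxSr // addsmx_sub sVU submx_refl.
rewrite (eqmx_rank E0) => le_tri _; apply: leq_trans le_tri; apply: tri_mono.
rewrite leq_sub2r // mxrankS // sub_capmx submx_refl /=.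
by case/andP: E0 => _; apply: submx_trans.
Qed.

End Planar.

Section Socle.
Variables (F : fieldType) (n : nat) (X Y V : 'M[F]_n) (N : nat).
Hypothesis XY : X *m Y = Y *m X.
Hypotheses (VX : (V *m X <= V)%MS) (VY : (V *m Y <= V)%MS).
Hypotheses (nilX : X ^+ N = 0) (nilY : Y ^+ N = 0).

(** Apply [X] as long as the vector stays outside [V], then do the same with [Y]; nilpotency stops
    both. [P] will be membership modulo [V] in the image of a module map. *)
Lemma socle_exists (P : 'rV[F]_n -> Prop) (u : 'rV[F]_n) :
  (forall w, P w -> P (w *m X)) -> (forall w, P w -> P (w *m Y)) ->
  P u -> ~~ (u <= V)%MS ->
  exists w, [/\ P w, ~~ (w <= V)%MS, (w *m X <= V)%MS & (w *m Y <= V)%MS].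
Proof.
have climb (T : 'M[F]_n) (Q : 'rV[F]_n -> Prop) w : T ^+ N = 0 ->
    (forall w, Q w -> Q (w *m T)) -> Q w -> ~~ (w <= V)%MS ->
    exists w', [/\ Q w', ~~ (w' <= V)%MS & (w' *m T <= V)%MS].
  move=> TN QT Qw wV.
  have : exists i, (w *m T ^+ i <= V)%MS by exists N; rewrite TN mulmx0 sub0mx.
  move=> /ex_minnP [[|i] wi mini]; first by rewrite expr0 mulmx1 (negPf wV) in wi.
  exists (w *m T ^+ i); split; last by rewrite -mulmxA -expmxSr.
    by elim: i {wi mini} => [|i IHi]; rewrite ?expr0 ?mulmx1 // expmxSr mulmxA; apply: QT.
  by apply/negP => /mini; rewrite ltnn.
move=> PX PY Pu uV.
have [w [Pw wV wX]] := climb X P u nilX PX Pu uV.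
have [||w' [[Pw' w'X] w'V w'Y]] :=
    climb Y (fun w => P w /\ (w *m X <= V)%MS) w nilY _ _ wV => //.
  move=> w' [Pw' w'X]; split; first exact: PY.
  by rewrite -mulmxA -XY mulmxA (submx_trans (submxMr _ w'X)).
by exists w'.
Qed.

End Socle.

(** * The tangent space at a commuting triple *)

Section Triples.
Variable F : fieldType.

Definition bracket n (A B : 'M[F]_n) : 'M[F]_n := A *m B - B *m A.

Definition triple n : Type := ('M[F]_n * 'M[F]_n * 'M[F]_n)%type.
HB.instance Definition _ n := Vector.on (triple n).

Lemma bracket_linear n (A : 'M[F]_n) : linear (bracket A).
Proof.
move=> a B C; rewrite /bracket mulmxDr mulmxDl -scalemxAr -scalemxAl scalerBr.
by rewrite opprD addrACA.
Qed.

Lemma bracketN n (A B : 'M[F]_n) : bracket A B = - bracket B A.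
Proof. by rewrite /bracket opprB. Qed.

(* The Hessian at (X, Y, Z) of the function tr X[Y,Z], as an endomorphism of the
   space of triples. *)
Definition dmap n (X Y Z : 'M[F]_n) (w : triple n) : triple n :=
  (bracket Y w.2 - bracket Z w.1.2, bracket Z w.1.1 - bracket X w.2,
   bracket X w.1.2 - bracket Y w.1.1).

Lemma dmap_linear n (X Y Z : 'M[F]_n) : linear (dmap X Y Z).
Proof.
move=> a [[A B] C] [[A' B'] C']; rewrite /dmap /= !bracket_linear.
have H (u v u' v' : 'M[F]_n) : a *: u + v - (a *: u' + v') = a *: (u - u') + (v - v').
  by rewrite opprD addrACA scalerBr.
by rewrite !H.
Qed.

HB.instance Definition _ n X Y Z :=
  GRing.isLinear.Build F (triple n) (triple n) _ (@dmap n X Y Z) (dmap_linear X Y Z).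

Definition tangent n (X Y Z : 'M[F]_n) : {vspace triple n} := lker (linfun (dmap X Y Z)).

Lemma mem_tangent n (X Y Z : 'M[F]_n) w : (w \in tangent X Y Z) = (dmap X Y Z w == 0).
Proof. by rewrite /tangent memv_ker lfunE. Qed.

Lemma tangentP n (X Y Z : 'M[F]_n) w : w \in tangent X Y Z <->
  [/\ bracket Y w.2 = bracket Z w.1.2, bracket Z w.1.1 = bracket X w.2
    & bracket X w.1.2 = bracket Y w.1.1].
Proof.
rewrite mem_tangent; split=> [/eqP [e1 e2 e3]|[e1 e2 e3]].
  by split; apply/eqP; rewrite -subr_eq0; apply/eqP.
by rewrite /dmap e1 e2 e3 !subrr.
Qed.

Lemma dim_triple n : dim (triple n) = (3 * n ^ 2)%N.
Proof. by rewrite -[LHS]/(n * n + n * n + n * n)%N; lia. Qed.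

Definition tform n (w v : triple n) : F :=
  \tr (w.1.1 *m v.1.1) + \tr (w.1.2 *m v.1.2) + \tr (w.2 *m v.2).

Lemma tform_dmap n (X Y Z : 'M[F]_n) w v :
  tform (dmap X Y Z w) v = tform w (dmap X Y Z v).
Proof.
case: w v => [[A B] C] [[A' B'] C']; rewrite /tform /dmap /bracket /=.
have trB (P Q : 'M[F]_n) : \tr (P - Q) = \tr P - \tr Q by rewrite raddfB.
rewrite !(mulmxBl, mulmxBr) !trB !mulmxA.
(* Every trace is rotated so that [X], [Y] or [Z] comes first; both sides then consist of the same
   terms. *)
have cycr (T P Q : 'M[F]_n) : \tr (P *m Q *m T) = \tr (T *m P *m Q).
  by rewrite mxtrace_mulC mulmxA.
have cycm (T P Q : 'M[F]_n) : \tr (P *m T *m Q) = \tr (T *m Q *m P).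
  by rewrite -mulmxA mxtrace_mulC.
rewrite !(cycr X) !(cycr Y) !(cycr Z) !(cycm X) !(cycm Y) !(cycm Z).
ring.
Qed.

End Triples.

Section RankOneMaps.
Variables (F : fieldType) (n : nat).

Lemma separating_col (V : 'M[F]_n) (v : 'rV[F]_n) : ~~ (v <= V)%MS ->
  exists2 xi : 'cV[F]_n, V *m xi = 0 & v *m xi = 1.
Proof.
rewrite submxE => /rV0Pn [j vj].
exists (((v *m cokermx V) 0 j)^-1 *: col j (cokermx V)).
  by rewrite colE -scalemxAr [V *m (_ *m _)]mulmxA mulmx_coker mul0mx scaler0.
apply/matrixP => a b; rewrite !ord1 colE -scalemxAr [v *m (_ *m delta_mx _ _)]mulmxA -colE !mxE eqxx.
by move: vj; rewrite !mxE => vj; rewrite mulVf.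
Qed.

Lemma sub_ker_coker m (u : 'M_(m, n)) (T V : 'M[F]_n) :
  (u <= kermx (T *m cokermx V))%MS = (u *m T <= V)%MS.
Proof. by rewrite sub_kermx mulmxA -submxE. Qed.

Lemma compl_base (U V : 'M[F]_n) : (V <= U)%MS ->
  exists B : 'M[F]_(\rank U - \rank V, n), (B <= U)%MS /\ (U <= V + B)%MS.
Proof.
move=> sVU.
have e : \rank (U :\: V)%MS = (\rank U - \rank V)%N.
  have := mxrank_cap_compl U V; have /capmx_idPr e := sVU.
  by rewrite e; lia.
rewrite -e; exists (row_base (U :\: V)%MS).
rewrite eq_row_base diffmxSl; split=> //.
rewrite -(addsmx_diff_cap_eq U V) addsmx_sub; apply/andP; split.
  by apply: submx_trans (addsmxSr _ _); rewrite eq_row_base.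
by apply: submx_trans (capmxSr _ _) (addsmxSl _ _).
Qed.

End RankOneMaps.

(** * The isotropic subspace attached to the filtration by powers of Z *)

Section Filtration.
Variables (F : fieldType) (n N : nat) (X Y Z : 'M[F]_n).
Hypotheses (XY : X *m Y = Y *m X) (XZ : X *m Z = Z *m X) (YZ : Y *m Z = Z *m Y).
Hypotheses (nilX : X ^+ N = 0) (nilY : Y ^+ N = 0) (nilZ : Z ^+ N = 0).

Local Notation Fz j := (Z ^+ j).

Definition soc (U V : 'M[F]_n) : 'M[F]_n :=
  (U :&: kermx (X *m cokermx V) :&: kermx (Y *m cokermx V))%MS.

Lemma sub_soc m (u : 'M_(m, n)) U V :
  (u <= soc U V)%MS = [&& (u <= U)%MS, (u *m X <= V)%MS & (u *m Y <= V)%MS].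
Proof. by rewrite !sub_capmx !sub_ker_coker -andbA. Qed.

Definition gap j := (\rank (Fz j) - \rank (Fz j.+1))%N.
Definition socdim j := (\rank (soc (Fz j) (Fz j.+1)) - \rank (Fz j.+1))%N.

Let FS j : (Fz j.+1 <= Fz j)%MS.
Proof. by rewrite expmxS submxMl. Qed.

Let FX j : (Fz j *m X <= Fz j)%MS.
Proof. by rewrite comm_expmx // submxMl. Qed.

Let FY j : (Fz j *m Y <= Fz j)%MS.
Proof. by rewrite comm_expmx // submxMl. Qed.

Let FZ m (u : 'M_(m, n)) j : (u <= Fz j)%MS -> (u *m Z <= Fz j.+1)%MS.
Proof. by move=> uF; rewrite expmxSr submxMr. Qed.

Let Fanti i j : (i <= j)%N -> (Fz j <= Fz i)%MS.
Proof.
move=> le_ij; rewrite -(subnK le_ij); elim: (j - i)%N => // k IHk.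
by apply: submx_trans IHk; rewrite addSn FS.
Qed.

Let parab (f : 'M[F]_n) := forall j, (Fz j *m f <= Fz j)%MS.
Let nilrad (f : 'M[F]_n) := forall j, (Fz j *m f <= Fz j.+1)%MS.

Let parab_lin a f g : parab f -> parab g -> parab (a *: f + g).
Proof.
by move=> hf hg j; rewrite mulmxDr -scalemxAr addmx_sub ?scalemx_sub.
Qed.

Let nilrad_lin a f g : nilrad f -> nilrad g -> nilrad (a *: f + g).
Proof.
by move=> hf hg j; rewrite mulmxDr -scalemxAr addmx_sub ?scalemx_sub.
Qed.

Let parab0 : parab 0. Proof. by move=> j; rewrite mulmx0 sub0mx. Qed.
Let nilrad0 : nilrad 0. Proof. by move=> j; rewrite mulmx0 sub0mx. Qed.

(* [parab] and [nilrad] are each other's orthogonal for the trace form; the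
   test maps are of rank one. *)
Let nilrad_perp g : (forall f, parab f -> \tr (g *m f) = 0) -> nilrad g.
Proof.
move=> gP j; apply/rV_subP => _ /submxP [c ->]; rewrite mulmxA.
set v := c *m Fz j; have vF : (v <= Fz j)%MS by rewrite submxMl.
apply/negPn/negP => /separating_col [xi Fxi vgxi].
have : parab (xi *m v).
  move=> i; case: (leqP i j) => [le_ij|lt_ji].
    by rewrite mulmxA (submx_trans (submxMl _ _)) // (submx_trans vF) ?Fanti.
  rewrite mulmxA; suff -> : Fz i *m xi = 0 by rewrite mul0mx sub0mx.
  by have /submxP [d ->] := Fanti lt_ji; rewrite -mulmxA Fxi mulmx0.
move=> /gP; rewrite mulmxA mxtrace_mulC mulmxA vgxi mxtrace1 => /eqP.
by rewrite oner_eq0.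
Qed.

Let parab_perp g : (forall f, nilrad f -> \tr (g *m f) = 0) -> parab g.
Proof.
move=> gP j; apply/rV_subP => _ /submxP [c ->]; rewrite mulmxA.
set v := c *m Fz j; have vF : (v <= Fz j)%MS by rewrite submxMl.
apply/negPn/negP => /separating_col [xi Fxi vgxi].
have : nilrad (xi *m v).
  move=> i; case: (ltnP i j) => [lt_ij|le_ji].
    by rewrite mulmxA (submx_trans (submxMl _ _)) // (submx_trans vF) ?Fanti.
  rewrite mulmxA; suff -> : Fz i *m xi = 0 by rewrite mul0mx sub0mx.
  by have /submxP [d ->] := Fanti le_ji; rewrite -mulmxA Fxi mulmx0.
move=> /gP; rewrite mulmxA mxtrace_mulC mulmxA vgxi mxtrace1 => /eqP.
by rewrite oner_eq0.
Qed.

Let inU (w : triple F n) := [/\ parab w.1.1, parab w.1.2 & nilrad w.2].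
(** By the duality of [parab] and [nilrad], this is the orthogonal of [inU] for the Hessian. *)
Let inQ (w : triple F n) := [/\ nilrad (dmap X Y Z w).1.1,
  nilrad (dmap X Y Z w).1.2 & parab (dmap X Y Z w).2].

Let inUQ w : inU w -> inQ w.
Proof.
case: w => [[A B] C] [/= hA hB hC].
have sub (f g : 'M[F]_n) : nilrad f -> nilrad g -> nilrad (f - g).
  by move=> hf hg; rewrite addrC -scaleN1r; apply: nilrad_lin.
have brC T : parab T -> nilrad (bracket T C).
  move=> hT j; rewrite /bracket mulmxBr addmx_sub ?eqmx_opp // mulmxA.
    by apply: submx_trans (submxMr _ (hT j)) (hC j).
  by apply: submx_trans (submxMr _ (hC j)) (hT j.+1).
have brZ T : parab T -> nilrad (bracket Z T).
  move=> hT j; rewrite /bracket mulmxBr addmx_sub ?eqmx_opp // mulmxA.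
    by rewrite -expmxSr.
  by rewrite FZ.
have brP S T : parab S -> parab T -> parab (bracket S T).
  move=> hS hT j; rewrite /bracket mulmxBr addmx_sub ?eqmx_opp // mulmxA.
    by apply: submx_trans (submxMr _ (hS j)) (hT j).
  by apply: submx_trans (submxMr _ (hT j)) (hS j).
split=> /=; [apply: sub|apply: sub|]; auto.
rewrite addrC -scaleN1r; apply: parab_lin; auto.
Qed.

Let tform_eq0 (w u v : triple F n) a :
  tform w u = 0 -> tform w v = 0 -> tform w (a *: u + v) = 0.
Proof.
rewrite /tform /= !mulmxDr -!scalemxAr !mxtraceD !mxtraceZ => u0 v0.
by rewrite -[RHS]addr0 -{1}(mulr0 a) -{1}u0 -v0; ring.
Qed.

(* With d = dmap: U is contained in Q, so dim dU <= dim dQ = dim Q - dim ker d,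
   while Q is the orthogonal of dU, so its codimension is at most dim dU. *)
Lemma dim_tangent_le_isotropic (U Q : {vspace triple F n}) :
  (forall w, w \in U <-> inU w) -> (forall w, w \in Q <-> inQ w) ->
  (\dim (tangent X Y Z) + 3 * n ^ 2 <= 2 * \dim Q)%N.
Proof.
move=> UE QE; pose D := (linfun (dmap X Y Z) @: U)%VS.
have sUQ : (U <= Q)%VS by apply/subvP => w /UE /inUQ /QE.
have sTQ : (tangent X Y Z <= Q)%VS.
  apply/subvP => w; rewrite mem_tangent => /eqP dw; apply/QE; rewrite /inQ dw.
  by split.
have leDQ : (\dim D + \dim (tangent X Y Z) <= \dim Q)%N.
  rewrite -(limg_ker_dim (linfun (dmap X Y Z)) Q) addnC.
  have -> : (Q :&: lker (linfun (dmap X Y Z)))%VS = tangent X Y Z by apply/capv_idPr.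
  by rewrite leq_add2l dimvS // limgS.
suff : (\dim {:triple F n} <= \dim Q + \dim D)%N.
  by rewrite dimvf dim_triple; lia.
pose f (w : triple F n) : 'rV[F]_(\dim D) := \row_i tform w (vbasis D)`_i.
have := @dim_ker_le F (triple F n) 'rV[F]_(\dim D) f fullv Q.
have -> : dim 'rV[F]_(\dim D) = \dim D by exact: mul1n.
apply.
  move=> a u v; apply/rowP => i; rewrite !mxE /tform /=.
  rewrite !mulmxDl -!scalemxAl !mxtraceD !mxtraceZ; ring.
move=> w _ /rowP fw; apply/QE.
have key u : inU u -> tform (dmap X Y Z w) u = 0.
  move=> /UE Uu; rewrite tform_dmap.
  have /coord_vbasis -> : dmap X Y Z u \in D.
    by rewrite -(lfunE (dmap X Y Z)) memv_img.
  elim/big_ind: _ => [|x y x0 y0|i _].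
  - by rewrite /tform !mulmx0 !mxtrace0 !addr0.
  - by rewrite -[x]scale1r; apply: tform_eq0.
  - rewrite -[_ *: _]addr0; apply: tform_eq0; last by rewrite /tform !mulmx0 !mxtrace0 !addr0.
    by have := fw i; rewrite !mxE.
split.
- apply: nilrad_perp => f' hf; have := key ((f', 0), 0); rewrite /tform /= !mulmx0.
  by rewrite mxtrace0 !addr0; apply; split.
- apply: nilrad_perp => f' hf; have := key ((0, f'), 0); rewrite /tform /= !mulmx0.
  by rewrite mxtrace0 addr0 add0r; apply; split.
- apply: parab_perp => f' hf; have := key ((0, 0), f'); rewrite /tform /= !mulmx0.
  by rewrite mxtrace0 !add0r; apply; split.
Qed.

(** These spaces descend from [inQ] at j = 0 into [inU] at j = N. *)
Let inK j (w : triple F n) :=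
  inQ w /\ forall i, (i < j)%N -> (Fz i *m w.2 <= Fz i.+1)%MS.

Let FT T j : T *m Z = Z *m T -> (Fz j *m T <= Fz j)%MS.
Proof. by move=> TZ; rewrite comm_expmx // submxMl. Qed.

Section OneDirection.
Variables (T T' C : 'M[F]_n) (j : nat).
Hypothesis TZ : T *m Z = Z *m T.
Hypothesis TT' : nilrad (bracket Z T' - bracket T C).
Hypothesis CF : forall i, (i < j)%N -> (Fz i *m C <= Fz i.+1)%MS.

(** Induction on [i]: F_(i+1) is F_i followed by [Z], and [Z T' = T' Z + [Z, T']], where [[Z, T']]
    equals [[T, C]] up to a map raising the filtration. *)
Lemma bracket_parab i : (i <= j)%N -> (Fz i *m T' <= Fz i)%MS.
Proof.
elim: i => [|i IHi] lt_ij; first by rewrite expr0 submx1.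
have -> : Fz i.+1 *m T' = Fz i *m (bracket Z T' - bracket T C) + Fz i *m T' *m Z
    + Fz i *m T *m C - Fz i *m C *m T.
  rewrite expmxSr /bracket !mulmxBr !mulmxA.
  have cancel (a b c d : 'M[F]_n) : a = a - b - (c - d) + b + c - d.
    by rewrite [a - b - _ + b]addrAC subrK -addrA subrK.
  exact: cancel.
rewrite !addmx_sub ?eqmx_opp ?TT' //.
- by rewrite FZ // IHi // ltnW.
- by apply: submx_trans (submxMr _ (FT i TZ)) (CF lt_ij).
- by apply: submx_trans (submxMr _ (CF lt_ij)) (FT i.+1 TZ).
Qed.

(** On the kernel of [Z] the bracket [[Z, T']] reduces to [- T' Z], which lands in F_(j+1); so [C]
    commutes there with [T] modulo F_(j+1). *)
Lemma bracket_quasi_comm (e : 'rV_n) : (e <= Fz j)%MS -> e *m Z = 0 ->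
  (e *m C *m T - e *m T *m C <= Fz j.+1)%MS.
Proof.
move=> eF eZ.
have -> : e *m C *m T - e *m T *m C = e *m (bracket Z T' - bracket T C) + e *m T' *m Z.
  by rewrite /bracket !mulmxBr !mulmxA eZ mul0mx sub0r addrAC addNr add0r opprB.
rewrite addmx_sub //; first by apply: submx_trans (submxMr _ eF) (TT' j).
by rewrite FZ //; apply: submx_trans (submxMr _ eF) (bracket_parab (leqnn j)).
Qed.

End OneDirection.

Lemma rank_ker_exp j : \rank (Fz j :&: kermx Z)%MS = gap j.
Proof. by have := mxrank_mul_ker (Fz j) Z; rewrite -expmxSr /gap; rank_lia. Qed.

Lemma rank_exp_anti j : (\rank (Fz j.+1) <= \rank (Fz j))%N.
Proof. exact: mxrankS. Qed.

(* For [w] in [inK j], the third component induces a map from z^jA to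
   z^jA / z^(j+1)A whose restriction to the kernel of Z is linear over F[X, Y].
   Such a restriction vanishes as soon as its composite with [th], which is
   injective on the socle, does. *)
Let K_step j (K K' : {vspace triple F n}) :
  (forall w, w \in K <-> inK j w) -> (forall w, w \in K' <-> inK j.+1 w) ->
  (\dim K <= \dim K' + (\rank (Fz j.+1) * gap j + gap j * socdim j))%N.
Proof.
move=> KE K'E; pose E := (Fz j :&: kermx Z)%MS.
have sEF : (E <= Fz j)%MS by rewrite capmxSl.
have EZ : E *m Z = 0 by apply/sub_kermxP; rewrite capmxSr.
have [D [sDF FD]] := compl_base sEF.
have [P PE] := quot_coord (FS j).
have sFS : (Fz j.+1 <= soc (Fz j) (Fz j.+1))%MS by rewrite sub_soc FS FX FY.
have [th thE] := quot_coord sFS.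
pose f (w : triple F n) := (D *m w.2 *m P, row_base E *m w.2 *m th).
have linf : linear f.
  by move=> a u v; rewrite /f /= !mulmxDr !mulmxDl -!scalemxAr -!scalemxAl.
have := @dim_ker_le F _ _ f K K' linf.
have -> : dim ('M[F]_(\rank (Fz j) - \rank E, \rank (Fz j) - \rank (Fz j.+1)) *
    'M[F]_(\rank E, \rank (soc (Fz j) (Fz j.+1)) - \rank (Fz j.+1)))%type =
    (\rank (Fz j.+1) * gap j + gap j * socdim j)%N.
  rewrite -[LHS]/((\rank (Fz j) - \rank E) * gap j + \rank E * socdim j)%N rank_ker_exp.
  by congr (_ * _ + _)%N; have := rank_exp_anti j; rewrite /gap; rank_lia.
apply=> w /KE [Qw Fw] [Dw Ew]; apply/K'E; split=> // i.
rewrite ltnS leq_eqVlt => /orP [/eqP {i}->|]; last exact: Fw.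
have sFw : (Fz j *m w.2 <= Fz j)%MS.
  case: (j) Fw => [|i] Fw; first by rewrite expr0 submx1.
  apply: submx_trans (Fw i (leqnn _)); rewrite submxMr //.
have [Q1 Q2 _] := Qw.
have commX := bracket_quasi_comm XZ Q2 Fw.
have commY : forall e : 'rV_n, (e <= Fz j)%MS -> e *m Z = 0 ->
    (e *m w.2 *m Y - e *m Y *m w.2 <= Fz j.+1)%MS.
  apply: (@bracket_quasi_comm Y w.1.2 w.2 j YZ _ Fw) => i.
  by rewrite -eqmx_opp -mulmxN opprB.
have sDw : (D *m w.2 <= Fz j.+1)%MS.
  by rewrite -PE ?Dw //; apply: submx_trans (submxMr _ sDF) sFw.
suff sEw : (E *m w.2 <= Fz j.+1)%MS.
  by apply: submx_trans (submxMr _ FD) _; rewrite addsmxMr addsmx_sub sEw.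
have Eth (e : 'rV_n) : (e <= E)%MS -> e *m w.2 *m th = 0.
  rewrite -(eq_row_base E) => /submxP [c ->].
  by rewrite -(mulmxA c) -(mulmxA c) Ew mulmx0.
apply/rV_subP => _ /submxP [c ->]; rewrite mulmxA; set e := c *m E.
have sE : (e <= E)%MS by rewrite submxMl.
apply/negPn/negP => eV.
(* The vectors representing, modulo F_(j+1), elements of the image of [E]. This set is stable under
   [X] and [Y], so a nonzero image would meet the socle, where [th] detects it. *)
pose Pw (u : 'rV[F]_n) :=
  exists2 e' : 'rV_n, (e' <= E)%MS & (u - e' *m w.2 <= Fz j.+1)%MS.
have stepP T : T *m Z = Z *m T ->
    (forall e : 'rV_n, (e <= Fz j)%MS -> e *m Z = 0 ->
      (e *m w.2 *m T - e *m T *m w.2 <= Fz j.+1)%MS) ->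
    forall u, Pw u -> Pw (u *m T).
  move=> TZ commT u [e' e'E ue']; exists (e' *m T).
    rewrite sub_capmx (submx_trans (submxMr _ (submx_trans e'E sEF))) ?FT //=.
    apply/sub_kermxP; rewrite -mulmxA TZ mulmxA.
    by move/submxP: e'E => [c' ->]; rewrite -[c' *m _ *m Z]mulmxA EZ mulmx0 mul0mx.
  have -> : u *m T - e' *m T *m w.2 = (u - e' *m w.2) *m T +
      (e' *m w.2 *m T - e' *m T *m w.2) by rewrite mulmxBl addrA subrK.
  rewrite addmx_sub //.
    by apply: submx_trans (submxMr _ ue') (FT _ TZ).
  apply: commT; first exact: submx_trans e'E sEF.
  by move/submxP: e'E => [c' ->]; rewrite -mulmxA EZ mulmx0.
have Pe : Pw (e *m w.2) by exists e; rewrite // subrr sub0mx.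
have [u [[e' e'E ue'] uV uX uY]] :=
  socle_exists XY (FY j.+1) nilX nilY (stepP X XZ commX) (stepP Y YZ commY) Pe eV.
have uF : (u <= Fz j)%MS.
  rewrite -[u](subrK (e' *m w.2)) addmx_sub ?(submx_trans ue') //.
  by apply: submx_trans (submxMr _ (submx_trans e'E sEF)) sFw.
move/negP: uV; apply; rewrite -thE ?sub_soc ?uF ?uX ?uY //.
rewrite -[u](subrK (e' *m w.2)) mulmxDl Eth // addr0.
by rewrite thE // (submx_trans ue').
Qed.

(** Vanishing on F_j filters [inU], from 0 at j = 0 to everything at j = N. *)
Let inR j (w : triple F n) :=
  inU w /\ [/\ Fz j *m w.1.1 = 0, Fz j *m w.1.2 = 0 & Fz j *m w.2 = 0].

(** A triple vanishing on F_(j+1) is determined on F_j by the images of a complement of dimension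
    [gap j]: two lie in F_j, the third in F_(j+1). *)
Let R_step j (R R' : {vspace triple F n}) :
  (forall w, w \in R <-> inR j w) -> (forall w, w \in R' <-> inR j.+1 w) ->
  (\dim R' <= \dim R + gap j * (2 * \rank (Fz j) + \rank (Fz j.+1)))%N.
Proof.
move=> RE R'E.
have [B [sBF FB]] := compl_base (FS j).
have [P PE] := quot_coord (sub0mx n (Fz j)).
have [P' P'E] := quot_coord (sub0mx n (Fz j.+1)).
pose f (w : triple F n) := ((B *m w.1.1 *m P, B *m w.1.2 *m P), B *m w.2 *m P').
have linf : linear f.
  by move=> a u v; rewrite /f /= !mulmxDr !mulmxDl -!scalemxAr -!scalemxAl.
have := @dim_ker_le F _ _ f R' R linf.
set d := dim _; have -> : d = (gap j * (2 * \rank (Fz j) + \rank (Fz j.+1)))%N.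
  rewrite {}/d -[LHS]/(gap j * (\rank (Fz j) - \rank (0%R : 'M[F]_n)) +
    gap j * (\rank (Fz j) - \rank (0%R : 'M[F]_n)) +
    gap j * (\rank (Fz j.+1) - \rank (0%R : 'M[F]_n)))%N.
  by rewrite !mxrank0 !subn0 !mulnDr; rank_lia.
apply=> w /R'E [[w1 w2 w3] [z1 z2 z3]] [e1 e2 e3]; apply/RE; split=> //.
have key T : Fz j.+1 *m T = 0 -> B *m T = 0 -> Fz j *m T = 0.
  move=> z b; apply/eqP; rewrite -submx0; apply: submx_trans (submxMr _ FB) _.
  by rewrite addsmxMr z b addsmx0 sub0mx.
split; apply: key => //; apply/eqP.
- by rewrite -submx0 -PE ?e1 //; apply: submx_trans (submxMr _ sBF) (w1 j).
- by rewrite -submx0 -PE ?e2 //; apply: submx_trans (submxMr _ sBF) (w2 j).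
- by rewrite -submx0 -P'E ?e3 //; apply: submx_trans (submxMr _ sBF) (w3 j).
Qed.

Let exU : exists U : {vspace triple F n}, forall w, w \in U <-> inU w.
Proof.
apply: pred_vspace => [|a [[A B] C] [[A' B'] C'] [/= h1 h2 h3] [/= h1' h2' h3']].
  by split=> /=.
by split=> /=; auto.
Qed.

Let inQ_lin a u v : inQ u -> inQ v -> inQ (a *: u + v).
Proof.
move=> [h1 h2 h3] [h1' h2' h3']; rewrite /inQ linearD linearZ /=.
by split; auto.
Qed.

Let inQ0 : inQ 0.
Proof. by rewrite /inQ linear0; split. Qed.

Let exK j : exists K : {vspace triple F n}, forall w, w \in K <-> inK j w.
Proof.
apply: pred_vspace => [|a u v [hu cu] [hv cv]].
  by split=> // i _; rewrite mulmx0 sub0mx.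
split; first exact: inQ_lin.
by move=> i lt_ij /=; rewrite mulmxDr -scalemxAr addmx_sub ?scalemx_sub ?cu ?cv.
Qed.

Let exR j : exists R : {vspace triple F n}, forall w, w \in R <-> inR j w.
Proof.
have [U UE] := exU.
apply: pred_vspace => [|a u v [/UE hu [u1 u2 u3]] [/UE hv [v1 v2 v3]]].
  by split; [apply/UE; rewrite mem0v | rewrite !mulmx0].
split; first by apply/UE; rewrite memvD // memvZ.
by rewrite /= !mulmxDr -!scalemxAr u1 u2 u3 v1 v2 v3 !scaler0 !addr0.
Qed.

(** Let r_i be the rank of [Z ^+ i], a the sum of [gap i] r_i and b that of [gap i] r_(i+1). The
    chains bound dim Q by 2a + 2b plus the sum of [gap i * socdim i]. Since [gap i] (r_i + r_(i+1))
    is a difference of squares, a + b = n^2, and [dim_tangent_le_isotropic] concludes. *)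
Lemma dim_tangent_le :
  (\dim (tangent X Y Z) <= n ^ 2 + 2 * \sum_(j < N) gap j * socdim j)%N.
Proof.
have [U UE] := exU.
have [K0 K0E] := exK 0; have K0Q w : w \in K0 <-> inQ w by rewrite K0E; split=> [[]|].
have := dim_tangent_le_isotropic UE K0Q.
have chainK j (K : {vspace triple F n}) : (forall w, w \in K <-> inK j w) ->
  (\dim K0 <= \dim K + \sum_(i < j) (\rank (Fz i.+1) * gap i + gap i * socdim i))%N.
  elim: j K => [|j IHj] K KE.
    rewrite big_ord0 addn0 dimvS //; apply/subvP => w /K0E ?; exact/KE.
  have [K1 K1E] := exK j; apply: leq_trans (IHj _ K1E) _.
  apply: leq_trans (leq_add (K_step K1E KE) (leqnn _)) _.
  by rewrite big_ord_recr /= -addnA leq_add2l addnC.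
have chainR j (R : {vspace triple F n}) : (forall w, w \in R <-> inR j w) ->
  (\dim R <= \sum_(i < j) gap i * (2 * \rank (Fz i) + \rank (Fz i.+1)))%N.
  elim: j R => [|j IHj] R RE.
    rewrite big_ord0 leqn0 dimv_eq0 -subv0; apply/subvP => w /RE [_ []].
    rewrite expr0 !mul1mx memv0; case: w => [[A B] C] /= -> -> ->; exact: eqxx.
  have [R1 R1E] := exR j; apply: leq_trans (R_step R1E RE) _.
  by rewrite big_ord_recr /= leq_add2r IHj.
have [KN KNE] := exK N; have [RN RNE] := exR N.
(* At level [N] the third component raises the filtration everywhere, and [bracket_parab] then makes
   the first two preserve it. *)
have sKR : (\dim KN <= \dim RN)%N.
  apply/dimvS/subvP => w /KNE [[Q1 Q2 Q3] KF]; apply/RNE.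
  have FN j : (N <= j)%N -> Fz j = 0 by apply: expmx_nil.
  have w3 : nilrad w.2.
    move=> j; case: (ltnP j N) => [/KF //|le_Nj].
    by rewrite FN // mul0mx sub0mx.
  have preserveN T T' : T *m Z = Z *m T -> nilrad (bracket Z T' - bracket T w.2) ->
      parab T'.
    by move=> TZ TT' j; apply: (bracket_parab TZ TT' (j := j)).
  split; last by rewrite nilZ !mul0mx.
  split=> //; first exact: (preserveN X).
  apply: (preserveN Y) => // j.
  by rewrite -eqmx_opp -mulmxN opprB.
have := chainK N KN KNE; have := chainR N RN RNE.
pose r i := \rank (Fz i).
have tele m : (\sum_(i < m) (gap i * (r i + r i.+1)) + r m ^ 2 = n ^ 2)%N.
  elim: m => [|m IHm]; first by rewrite big_ord0 add0n /r expr0 mxrank1.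
  rewrite -IHm big_ord_recr /= -addnA; congr (_ + _)%N.
  have : (r m.+1 <= r m)%N by apply: rank_exp_anti.
  by rewrite /gap -/(r m) -/(r m.+1); move: (r m) (r m.+1) => a b; nia.
have rN : r N = 0%N by rewrite /r nilZ mxrank0.
have := tele N; rewrite rN.
have -> : (\sum_(i < N) gap i * (2 * \rank (Fz i) + \rank (Fz i.+1)) =
  \sum_(i < N) gap i * (r i + r i.+1) + \sum_(i < N) gap i * r i)%N.
  by rewrite -big_split; apply: eq_bigr => i _; rewrite /= /r; lia.
have -> : (\sum_(i < N) (\rank (Fz i.+1) * gap i + gap i * socdim i) =
  \sum_(i < N) gap i * r i.+1 + \sum_(i < N) gap i * socdim i)%N.
  by rewrite -big_split; apply: eq_bigr => i _; rewrite /= /r mulnC.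
have -> : (\sum_(i < N) gap i * (r i + r i.+1) =
  \sum_(i < N) gap i * r i + \sum_(i < N) gap i * r i.+1)%N.
  by rewrite -big_split; apply: eq_bigr => i _; rewrite /= mulnDr.
move: sKR; lia.
Qed.

End Filtration.

Definition cyclic_vector (F : fieldType) n (X Y Z : 'M[F]_n) (v : 'rV[F]_n) :=
  forall W : 'M[F]_n, (v <= W)%MS ->
    (W *m X <= W)%MS -> (W *m Y <= W)%MS -> (W *m Z <= W)%MS -> (1%:M <= W)%MS.

(** * Generic linear forms *)

Section GenericRank.
Variables (F : numClosedFieldType) (n : nat).
Implicit Types A B T : 'M[F]_n.

Definition line_mx A B : 'M[{poly F}]_n := map_mx polyC A + 'X *: map_mx polyC B.

Lemma eval_line_mx A B t : map_mx (horner^~ t) (line_mx A B) = A + t *: B.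
Proof. by apply/matrixP => i j; rewrite !mxE !hornerE. Qed.

Lemma eval_mxM m p q (M : 'M[{poly F}]_(m, p)) (M' : 'M_(p, q)) t :
  map_mx (horner^~ t) (M *m M') = map_mx (horner^~ t) M *m map_mx (horner^~ t) M'.
Proof. by rewrite -[LHS]/(map_mx (horner_eval t) (M *m M')) map_mxM. Qed.

Lemma eval_mxX (M : 'M[{poly F}]_n) j t :
  map_mx (horner^~ t) (M ^+ j) = map_mx (horner^~ t) M ^+ j.
Proof.
elim: j => [|j IHj]; last by rewrite !expmxS eval_mxM IHj.
by rewrite !expr0 -[LHS]/(map_mx (horner_eval t) 1%:M) map_mx1.
Qed.

Lemma line_rank A B t0 j : exists2 q : {poly F}, q.[t0] != 0 &
  forall t, q.[t] != 0 -> (\rank ((A + t0 *: B) ^+ j) <= \rank ((A + t *: B) ^+ j))%N.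
Proof.
have [q q0 qP] := rank_semicont (line_mx A B ^+ j) t0; exists q => // t /qP.
by rewrite !eval_mxX !eval_line_mx.
Qed.

Lemma exists_nonroot (q : {poly F}) : q != 0 -> exists t, q.[t] != 0.
Proof. by move/closed_nonrootP => [t]; exists t. Qed.

Lemma horner_neq0 (q : {poly F}) t : q.[t] != 0 -> q != 0.
Proof. by apply: contraNneq => ->; rewrite horner0. Qed.

(* If the rank of [(A + t T)^(j+1)] does not jump at [t = 0], differentiating a
   kernel vector along the line shows that [T A^j] maps the kernel of [A^(j+1)]
   into its image. *)
Lemma generic_ker_im A T j (q : {poly F}) (u : 'rV[F]_n) :
  A *m T = T *m A -> q != 0 ->
  (forall t, q.[t] != 0 -> (\rank ((A + t *: T) ^+ j.+1) <= \rank (A ^+ j.+1))%N) ->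
  u *m A ^+ j.+1 = 0 -> (u *m T *m A ^+ j <= A ^+ j.+1)%MS.
Proof.
move=> AT q0 qP uA.
pose S := line_mx A T; pose PA := map_mx (@polyC F) A; pose PT := map_mx (@polyC F) T.
(* Difference quotient of the k-th power along the line; its value at 0 is the derivative k T
   A^(k-1). *)
pose E := fix E k := if k is k'.+1 then PT *m PA ^+ k' + S *m E k' else 0.
have SE k : S ^+ k = PA ^+ k + 'X *: E k.
  elim: k => [|k IHk]; first by rewrite !expr0 scaler0 addr0.
  rewrite expmxS IHk mulmxDr {1}/S /line_mx mulmxDl -/PA -/PT -expmxS -addrA.
  by congr (_ + _); rewrite /= scalerDr -scalemxAl -scalemxAr.
have evC m p (B : 'M[F]_(m, p)) t : map_mx (horner^~ t) (map_mx (@polyC F) B) = B.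
  by apply/matrixP => a b; rewrite !mxE hornerC.
have E0 k : map_mx (horner^~ 0) (E k) = (T *m A ^+ k.-1) *+ k.
  elim: k => [|k IHk]; first by apply/matrixP => a b; rewrite !mxE horner0.
  rewrite -[LHS]/(map_mx (horner_eval 0) _) raddfD /= -![map_mx (horner_eval 0) _]/(map_mx (horner^~ 0) _).
  rewrite !eval_mxM eval_mxX IHk !evC eval_line_mx scale0r addr0 mulrS; congr (_ + _).
  case: k {IHk} => [|k]; first by rewrite !mulr0n mulmx0.
  by rewrite /= -scaler_nat -scalemxAr scaler_nat mulmxA AT -mulmxA -expmxS.
(* At nonzero t the lower row is [t^-1] times [u *m (A + t *: T) ^+ j.+1], so it does not raise the
   rank; by semicontinuity it does not at t = 0 either. *)
pose M := col_mx (S ^+ j.+1) (map_mx (@polyC F) u *m E j.+1).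
have [q' q'0 q'P] := rank_semicont M 0.
have : q * (q' * 'X) != 0.
  by rewrite !mulf_neq0 ?polyX_eq0 // (horner_neq0 q'0).
move=> /exists_nonroot [t]; rewrite !hornerM hornerX !mulf_eq0 !negb_or => /and3P [qt q't t0].
have evM s : map_mx (horner^~ s) M =
    col_mx ((A + s *: T) ^+ j.+1) (u *m map_mx (horner^~ s) (E j.+1)).
  by rewrite /M map_col_mx eval_mxX eval_line_mx eval_mxM evC.
have := q'P t q't; rewrite !evM E0 scale0r addr0 => le_rank.
have sub : (u *m map_mx (horner^~ t) (E j.+1) <= (A + t *: T) ^+ j.+1)%MS.
  have -> : u *m map_mx (horner^~ t) (E j.+1) = t^-1 *: u *m (A + t *: T) ^+ j.+1.
    have := congr1 (map_mx (horner^~ t)) (SE j.+1); rewrite eval_mxX eval_line_mx => ->.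
    have -> : map_mx (horner^~ t) (PA ^+ j.+1 + 'X *: E j.+1) =
        A ^+ j.+1 + t *: map_mx (horner^~ t) (E j.+1).
      rewrite -{1}(evC _ _ A t) -eval_mxX.
      by apply/matrixP => a b; rewrite !mxE !hornerE.
    by rewrite mulmxDr -!scalemxAl uA scaler0 add0r -scalemxAr scalerA mulVf // scale1r.
  by rewrite submxMl.
have rM : \rank (col_mx ((A + t *: T) ^+ j.+1) (u *m map_mx (horner^~ t) (E j.+1))) =
    \rank ((A + t *: T) ^+ j.+1).
  apply/eqmx_rank/andP; split; first by rewrite col_mx_sub submx_refl.
  by rewrite -addsmxE addsmxSl.
move: le_rank; rewrite rM => /leq_trans /(_ (qP t qt)).
set w := u *m _ => le_rank.
have sc : (A ^+ j.+1 <= col_mx (A ^+ j.+1) w)%MS by rewrite -addsmxE addsmxSl.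
have : (col_mx (A ^+ j.+1) w <= A ^+ j.+1)%MS.
  by rewrite -(geq_leqif (mxrank_leqif_sup sc)).
rewrite col_mx_sub => /andP [_]; rewrite /w /= -scaler_nat -scalemxAr mulmxA.
move=> /(scalemx_sub (j.+1%:R)^-1); rewrite scalerA mulVf ?scale1r //.
by rewrite pnatr_eq0.
Qed.

Lemma expmxD_nil A B p q : A *m B = B *m A -> A ^+ p = 0 -> B ^+ q = 0 ->
  (A + B) ^+ (p + q) = 0.
Proof.
move=> AB Ap Bq; rewrite exprDn_comm // big1 // => i _.
case: (leqP q i) => [le_qi|lt_iq]; first by rewrite (expmx_nil Bq) // mulr0 mul0rn.
by rewrite (@expmx_nil _ _ A p) ?mul0r ?mul0rn // ; lia.
Qed.

Section Choice.
Variables (X Y Z : 'M[F]_n) (M : nat).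
Hypotheses (XY : X *m Y = Y *m X) (XZ : X *m Z = Z *m X) (YZ : Y *m Z = Z *m Y).

(* Z' maximizes the sum of the ranks of its powers, so that along every line
   through Z' all these ranks are generically constant. *)
Lemma generic_direction : exists a b, let Z' := Z + a *: X + b *: Y in
  [/\ forall j (u : 'rV[F]_n), (j.+1 < M)%N -> u *m Z' ^+ j.+1 = 0 ->
        (u *m X *m Z' ^+ j <= Z' ^+ j.+1)%MS /\ (u *m Y *m Z' ^+ j <= Z' ^+ j.+1)%MS
    & forall a' b' k, (k < M)%N ->
        (\rank ((Z + a' *: X + b' *: Y) ^+ k) <= \rank (Z' ^+ k))%N].
Proof.
pose ZZ a b := Z + a *: X + b *: Y.
pose rho a b := (\sum_(j < M) \rank (ZZ a b ^+ j))%N.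
pose D d := `[< exists a b, rho a b = d >].
have exD : exists d, D d by exists (rho 0 0); apply/asboolP; exists 0, 0.
have leD d : D d -> (d <= M * n)%N.
  move=> /asboolP [a [b <-]]; rewrite -[M in (_ <= M * _)%N]card_ord -sum_nat_const.
  by apply: leq_sum => j _; apply: rank_leq_row.
case: (ex_maxnP exD leD) => d /asboolP [a [b ab_d]] max_d; exists a, b => Z'.
(* Generically on the line no rank is smaller than at [Z'], while their sum is at most its value at
   [Z']; so all of them agree. *)
have line (T : 'M[F]_n) : (forall t, exists a' b', Z' + t *: T = ZZ a' b') ->
  exists2 q : {poly F}, q != 0 & forall t, q.[t] != 0 ->
    forall j, (j < M)%N -> \rank ((Z' + t *: T) ^+ j) = \rank (Z' ^+ j).
  move=> TZ.
  have [q q0 qP] : exists2 q : {poly F}, q != 0 & forall t, q.[t] != 0 ->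
      forall j, (j < M)%N -> (\rank (Z' ^+ j) <= \rank ((Z' + t *: T) ^+ j))%N.
    elim: (M) => [|m [q q0 qP]]; first by exists 1; rewrite ?oner_neq0.
    have [q' q'0 q'P] := line_rank Z' T 0 m.
    exists (q * q'); first by rewrite mulf_neq0 // (horner_neq0 q'0).
    move=> t; rewrite hornerM mulf_eq0 negb_or => /andP [qt q't] j.
    rewrite ltnS leq_eqVlt => /orP [/eqP ->|]; last exact: qP.
    by have := q'P t q't; rewrite scale0r addr0.
  exists q => // t qt.
  have sum_le : (\sum_(j < M) \rank ((Z' + t *: T) ^+ j) <= \sum_(j < M) \rank (Z' ^+ j))%N.
    rewrite -/(rho a b) ab_d; have [a' [b' ->]] := TZ t.
    by apply: max_d; apply/asboolP; exists a', b'.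
  move=> j lt_jM; apply/eqP; rewrite eqn_leq (qP t qt j lt_jM) andbT.
  have bigDj (f : nat -> nat) : (\sum_(i < M) f i =
      f j + \sum_(i < M | i != Ordinal lt_jM) f i)%N by rewrite (bigD1 (Ordinal lt_jM)).
  move: sum_le; rewrite (bigDj (fun i => \rank ((Z' + t *: T) ^+ i))).
  rewrite (bigDj (fun i => \rank (Z' ^+ i))) => sum_le.
  have : (\sum_(i < M | i != Ordinal lt_jM) \rank (Z' ^+ i) <=
      \sum_(i < M | i != Ordinal lt_jM) \rank ((Z' + t *: T) ^+ i))%N.
    by apply: leq_sum => i _; apply: qP.
  move=> sum_ge; rewrite -(leq_add2r (\sum_(i < M | i != Ordinal lt_jM) \rank (Z' ^+ i))%N).
  by apply: leq_trans sum_le; rewrite leq_add2l.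
have ker_im T j (u : 'rV[F]_n) : T *m Z' = Z' *m T ->
    (forall t, exists a' b', Z' + t *: T = ZZ a' b') ->
    (j.+1 < M)%N -> u *m Z' ^+ j.+1 = 0 -> (u *m T *m Z' ^+ j <= Z' ^+ j.+1)%MS.
  move=> TZ' /line [q q0 qP] lt_jM uZ; apply: (generic_ker_im (esym TZ') q0 _ uZ) => t qt.
  by rewrite qP.
split=> [j u lt_jM uZ|a' b' k lt_kM].
  split; (apply: ker_im => //; last move=> t).
  - by rewrite /Z' !mulmxDr !mulmxDl -!scalemxAr -!scalemxAl XZ XY.
  - by exists (a + t), b; apply/matrixP => i' j'; rewrite !mxE; ring.
  - by rewrite /Z' !mulmxDr !mulmxDl -!scalemxAr -!scalemxAl YZ XY.
  - by exists a, (b + t); apply/matrixP => i' j'; rewrite !mxE; ring.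
(* Join the competitor to [Z'] by a line: the generic rank is at least the rank at t = 1 and equals
   the rank at [Z']. *)
pose T := ZZ a' b' - Z'.
have [q q0 qP] : exists2 q : {poly F}, q != 0 & forall t, q.[t] != 0 ->
    forall j, (j < M)%N -> \rank ((Z' + t *: T) ^+ j) = \rank (Z' ^+ j).
  apply: line => t; exists (a + t * (a' - a)), (b + t * (b' - b)).
  rewrite /T /Z' /ZZ !scalerDl -!scalerA !scalerBl !scalerBr.
  apply/matrixP => i j; rewrite !mxE; ring.
have [q' q'1 q'P] := line_rank Z' T 1 k.
have /exists_nonroot [t] : q * q' != 0 by rewrite mulf_neq0 // (horner_neq0 q'1).
rewrite hornerM mulf_eq0 negb_or => /andP [qt q't].
rewrite -(qP t qt k lt_kM); apply: leq_trans (q'P t q't).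
by rewrite scale1r /T [Z' + _]addrC subrK.
Qed.

End Choice.

End GenericRank.

(** * Commuting nilpotent triples *)

Section TangentInvariance.
Variables (F : fieldType) (n : nat).
Implicit Types X Y Z : 'M[F]_n.

Lemma bracket_scalar (A B : 'M[F]_n) a : bracket (A - a%:M) B = bracket A B.
Proof.
by rewrite /bracket mulmxBl mulmxBr mul_scalar_mx mul_mx_scalar opprB addrA subrK.
Qed.

Lemma tangent_translate X Y Z p q r :
  tangent (X - p%:M) (Y - q%:M) (Z - r%:M) = tangent X Y Z.
Proof.
by apply/vspaceP => w; apply/idP/idP => /tangentP h; apply/tangentP; move: h; rewrite !bracket_scalar.
Qed.

Lemma dim_tangent_rot X Y Z : (\dim (tangent X Y Z) <= \dim (tangent Y Z X))%N.
Proof.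
apply: (@dim_inj_le _ _ (triple F n) (fun w : triple F n => ((w.1.2, w.2), w.1.1))).
- by [].
- by move=> [[A B] C] _ [/= -> -> ->].
- by move=> [[A B] C] /tangentP /= [e1 e2 e3]; apply/tangentP; rewrite /= e1 e2 e3.
Qed.

Lemma dim_tangent_shear X Y Z a b :
  (\dim (tangent X Y Z) <= \dim (tangent X Y (Z + a *: X + b *: Y)))%N.
Proof.
apply: (@dim_inj_le _ _ (triple F n)
  (fun w : triple F n => ((w.1.1, w.1.2), w.2 + a *: w.1.1 + b *: w.1.2))).
- move=> c [[A B] C] [[A' B'] C'] /=; congr (_, _) => /=.
  by apply/matrixP => i j; rewrite !mxE; ring.
- by move=> [[A B] C] _ [/= -> ->]; rewrite !scaler0 !addr0 => ->.
- move=> [[A B] C] /tangentP /= [e1 e2 e3]; apply/tangentP => /=.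
  have R (T A1 A2 A3 : 'M[F]_n) : bracket T (A1 + a *: A2 + b *: A3) =
      bracket T A1 + a *: bracket T A2 + b *: bracket T A3.
    by rewrite addrC [A1 + _]addrC !bracket_linear [LHS]addrC (addrC (a *: _)).
  have L (T A1 A2 A3 : 'M[F]_n) : bracket (A1 + a *: A2 + b *: A3) T =
      bracket A1 T + a *: bracket A2 T + b *: bracket A3 T.
    rewrite bracketN R !opprD -!scalerN -!bracketN; congr (_ + _ + _).
    by rewrite /bracket opprK addrC.
  by rewrite !R !L e1 -e2 e3.
Qed.

End TangentInvariance.

Section Local.
Variables (F : numClosedFieldType) (n : nat).

Section GenericZ.
Variables (N : nat) (X Y Z : 'M[F]_n) (v : 'rV[F]_n).
Hypotheses (XY : X *m Y = Y *m X) (XZ : X *m Z = Z *m X) (YZ : Y *m Z = Z *m Y).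
Hypotheses (nilX : X ^+ N = 0) (nilY : Y ^+ N = 0) (nilZ : Z ^+ N = 0).
Hypothesis cyc : cyclic_vector X Y Z v.
Hypothesis gen : forall j (u : 'rV[F]_n), u *m Z ^+ j.+1 = 0 ->
  (u *m X *m Z ^+ j <= Z ^+ j.+1)%MS /\ (u *m Y *m Z ^+ j <= Z ^+ j.+1)%MS.

Let stX j : (Z ^+ j *m X <= Z ^+ j)%MS.
Proof. by rewrite comm_expmx // submxMl. Qed.

Let stY j : (Z ^+ j *m Y <= Z ^+ j)%MS.
Proof. by rewrite comm_expmx // submxMl. Qed.

Let FS j : (Z ^+ j.+1 <= Z ^+ j)%MS.
Proof. by rewrite expmxS submxMl. Qed.

Let S j := soc X Y (Z ^+ j) (Z ^+ j.+1).

(** Slice [j] is cyclic over F[X, Y], as [planar_socle] requires: for [W] stable under [X] and [Y]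
    and containing F_(j+1), the vectors sent into [W] by [Z ^+ j] are also stable under [Z], so
    [cyc] applies. *)
Let tri_gap j : (tri (socdim X Y Z j) <= gap Z j)%N.
Proof.
apply: (@planar_socle _ _ X Y (Z ^+ j) (Z ^+ j.+1) (v *m Z ^+ j) N) => //.
- by rewrite submxMl.
- move=> W ZW vW WX WY.
  have : (1%:M <= kermx (Z ^+ j *m cokermx W))%MS.
    have kW m (u : 'M_(m, n)) : (u <= kermx (Z ^+ j *m cokermx W))%MS -> (u *m Z ^+ j <= W)%MS.
      by rewrite sub_ker_coker.
    apply: cyc; rewrite sub_ker_coker //.
    + by rewrite -mulmxA -comm_expmx // mulmxA (submx_trans (submxMr _ (kW _ _ (submx_refl _)))).
    + by rewrite -mulmxA -comm_expmx // mulmxA (submx_trans (submxMr _ (kW _ _ (submx_refl _)))).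
    + by rewrite -mulmxA -expmxS (submx_trans (submxMl _ _)).
  by rewrite sub_ker_coker mul1mx.
- by have := submx_refl (S j); rewrite sub_soc => /and3P [].
- by rewrite sub_soc FS stX stY.
- by have := submx_refl (S j); rewrite sub_soc => /and3P [].
- by have := submx_refl (S j); rewrite sub_soc => /and3P [].
Qed.

Let E j := (Z ^+ j :&: kermx Z)%MS.

(* This is where genericity of Z enters. *)
Let sES j : (E j <= S j)%MS.
Proof.
apply/rV_subP => u; rewrite sub_capmx => /andP [uF /sub_kermxP uZ].
rewrite sub_soc uF /=; have /submxP [c uE] := uF.
have cZ : c *m Z ^+ j.+1 = 0 by rewrite expmxSr mulmxA -uE uZ.
have [gX gY] := gen cZ.
by rewrite uE -!mulmxA !comm_expmx // !mulmxA gX gY.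
Qed.

(** [E j] has dimension [gap Z j]. It lies in the socle [S j], and the part lost modulo F_(j+1) is
    contained in [E j.+1]. *)
Let drop_gap j : (gap Z j <= gap Z j.+1 + socdim X Y Z j)%N.
Proof.
have s1 : (E j + Z ^+ j.+1 <= S j)%MS.
  by rewrite addsmx_sub sES sub_soc FS stX stY.
have s2 : (E j :&: Z ^+ j.+1 <= E j.+1)%MS.
  by rewrite sub_capmx capmxSr /= (submx_trans (capmxSl _ _)) // capmxSr.
have rE i : \rank (E i) = gap Z i := rank_ker_exp Z i.
have l1 : (\rank (E j + Z ^+ j.+1)%MS <= \rank (S j))%N := mxrankS s1.
have l2 : (\rank (E j :&: Z ^+ j.+1)%MS <= gap Z j.+1)%N by rewrite -rE mxrankS.
have e : (\rank (E j + Z ^+ j.+1)%MS + \rank (E j :&: Z ^+ j.+1)%MS =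
  gap Z j + \rank (Z ^+ j.+1))%N by rewrite -rE mxrank_sum_cap.
have -> : socdim X Y Z j = (\rank (S j) - \rank (Z ^+ j.+1))%N by [].
by rank_lia.
Qed.

Let decr_gap j : (gap Z j.+1 <= gap Z j)%N.
Proof. by rewrite -!rank_ker_exp mxrankS // capmxS. Qed.

Let rankE j : \rank (Z ^+ j) = (gap Z j + \rank (Z ^+ j.+1))%N.
Proof. by rewrite /gap subnK // rank_exp_anti. Qed.

Let rankN : \rank (Z ^+ N) = 0%N.
Proof. by rewrite nilZ mxrank0. Qed.

Let sum_gap : (\sum_(j < N) gap Z j = n)%N.
Proof.
have tele m : (\sum_(j < m) gap Z j + \rank (Z ^+ m) = n)%N.
  elim: m => [|m IHm]; first by rewrite big_ord0 add0n expr0 mxrank1.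
  by rewrite big_ord_recr /= -addnA -rankE.
by rewrite -[RHS](tele N) rankN addn0.
Qed.

Let weightE : (weight (gap Z) (socdim X Y Z) 0 N =
  n + 2 * \sum_(j < N) gap Z j * socdim X Y Z j)%N.
Proof.
transitivity (\sum_(j < N) gap Z j + 2 * \sum_(j < N) gap Z j * socdim X Y Z j)%N.
  rewrite /weight add0n big_mkord big_distrr -big_split /=.
  by apply: eq_bigr => i _; lia.
by rewrite sum_gap.
Qed.

Lemma generic_bound : (\dim (tangent X Y Z) + n <= n ^ 2 + maxT n)%N.
Proof.
have := dim_tangent_le XY XZ YZ nilX nilY nilZ.
have := weight_le tri_gap drop_gap rankE rankN N 0.
rewrite weightE expr0 mxrank1; lia.
Qed.

Lemma generic_equality k : n = tet k ->
  (\dim (tangent X Y Z) + n)%N = (n ^ 2 + maxT n)%N -> Z ^+ k = 0.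
Proof.
move=> nk eqn.
have := weight_eq (m := N) (k := k) (j := 0) tri_gap drop_gap decr_gap rankE rankN.
rewrite expr0 mxrank1 add0n => /(_ nk) h; apply/eqP; rewrite -mxrank_eq0; apply/eqP/h.
have := dim_tangent_le XY XZ YZ nilX nilY nilZ.
have := weight_le tri_gap drop_gap rankE rankN N 0.
rewrite expr0 mxrank1 weightE; lia.
Qed.

End GenericZ.

Variables (N : nat) (X Y Z : 'M[F]_n) (v : 'rV[F]_n).
Hypotheses (XY : X *m Y = Y *m X) (XZ : X *m Z = Z *m X) (YZ : Y *m Z = Z *m Y).
Hypotheses (nilX : X ^+ N = 0) (nilY : Y ^+ N = 0) (nilZ : Z ^+ N = 0).
Hypothesis cyc : cyclic_vector X Y Z v.

Lemma local_bound : (\dim (tangent X Y Z) + n <= n ^ 2 + maxT n)%N /\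
  forall k, n = tet k -> (\dim (tangent X Y Z) + n)%N = (n ^ 2 + maxT n)%N ->
    forall a b, (Z + a *: X + b *: Y) ^+ k = 0.
Proof.
(* Powers from [N + N + N] on vanish in every direction; the summand [n.+2] puts each [k] with
   [n = tet k] below [M]. *)
pose M := (N + N + N + n.+2)%N.
have [a [b []]] := generic_direction M XY XZ YZ; set Z' := _ + _ => genZ maxZ.
have XZ' : X *m Z' = Z' *m X.
  by rewrite /Z' !mulmxDr !mulmxDl -!scalemxAr -!scalemxAl XZ XY.
have YZ' : Y *m Z' = Z' *m Y.
  by rewrite /Z' !mulmxDr !mulmxDl -!scalemxAr -!scalemxAl YZ XY.
have nilZZ a' b' : (Z + a' *: X + b' *: Y) ^+ (N + N + N) = 0.
  have scale_nil c (A : 'M[F]_n) : A ^+ N = 0 -> (c *: A) ^+ N = 0.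
    by move=> AN; rewrite expmxZ AN scaler0.
  apply: expmxD_nil (scale_nil b' _ nilY).
    by rewrite mulmxDl mulmxDr -!scalemxAr -!scalemxAl !scalerA YZ XY (mulrC a').
  apply: expmxD_nil nilZ (scale_nil a' _ nilX).
  by rewrite -scalemxAr -scalemxAl XZ.
pose N' := (N + N + N)%N.
have leN : (N <= N')%N by rewrite /N'; lia.
have nX := expmx_nil nilX leN; have nY := expmx_nil nilY leN.
have nZ : Z' ^+ N' = 0 := nilZZ a b.
have cyc' : cyclic_vector X Y Z' v.
  move=> W vW WX WY WZ; apply: cyc => //.
  have -> : Z = Z' - a *: X - b *: Y by rewrite /Z' addrAC addrK addrK.
  rewrite !mulmxBr -!scalemxAr !addmx_sub ?eqmx_opp ?scalemx_sub //.
have gen j (u : 'rV[F]_n) : u *m Z' ^+ j.+1 = 0 ->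
    (u *m X *m Z' ^+ j <= Z' ^+ j.+1)%MS /\ (u *m Y *m Z' ^+ j <= Z' ^+ j.+1)%MS.
  case: (ltnP j.+1 M) => [lt_jM uZ|le_Mj _]; first exact: genZ.
  by rewrite (expmx_nil nZ) ?mulmx0 ?sub0mx // /N'; move: le_Mj; rewrite /M; lia.
have shear := dim_tangent_shear X Y Z a b.
have bound := generic_bound XY XZ' YZ' nX nY nZ cyc' gen.
split=> [|k nk eqn a' b']; first by move: shear bound; rewrite -/Z'; lia.
have Zk : Z' ^+ k = 0.
  apply: (generic_equality XY XZ' YZ' nX nY nZ cyc' gen nk).
  by move: shear bound; rewrite -/Z'; lia.
apply/eqP; rewrite -mxrank_eq0 -leqn0; apply: leq_trans (maxZ a' b' k _) _.
  by rewrite /M; have := leq_tet k; lia.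
by rewrite Zk mxrank0.
Qed.

End Local.

Section Polarization.
Variables (F : numClosedFieldType) (n : nat).

Lemma poly_mx_eq0 m (G : nat -> 'M[F]_n) :
  (forall t, \sum_(i < m) t ^+ i *: G i = 0) -> forall i, (i < m)%N -> G i = 0.
Proof.
move=> G0 i lt_im; apply/matrixP => a b; rewrite mxE.
pose p := \poly_(i < m) G i a b.
suff : p = 0 by move=> /(congr1 (fun p : {poly F} => p`_i)); rewrite coef_poly lt_im coef0.
apply/eqP/negPn/negP => /exists_nonroot [t /negP]; apply; apply/eqP.
have := congr1 (fun M : 'M[F]_n => M a b) (G0 t); rewrite summxE mxE => <-.
by rewrite horner_poly; apply: eq_bigr => j _; rewrite mxE mulrC.
Qed.

(** Compare coefficients of [t ^+ i], the binomials being invertible in characteristic zero. The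
    factor [C] allows a second polarization in another parameter. *)
Lemma polarize_mx (A B C : 'M[F]_n) k : A *m B = B *m A ->
  (forall t, (A + t *: B) ^+ k *m C = 0) ->
  forall i, (i <= k)%N -> A ^+ (k - i) *m B ^+ i *m C = 0.
Proof.
move=> AB AB0 i le_ik.
suff : (A ^+ (k - i) *m B ^+ i *m C) *+ 'C(k, i) = 0.
  move=> /eqP; rewrite -scaler_nat scaler_eq0 pnatr_eq0 => /orP [/eqP|/eqP //].
  by have := bin_gt0 k i; rewrite le_ik => /[swap] ->.
apply: (@poly_mx_eq0 k.+1 (fun i => (A ^+ (k - i) *m B ^+ i *m C) *+ 'C(k, i))) => // t.
rewrite -[RHS](AB0 t) exprDn_comm; last first.
  by rewrite /GRing.comm -[LHS]/(A *m (t *: B)) -[RHS]/((t *: B) *m A) -scalemxAr -scalemxAl AB.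
rewrite mulmx_suml; apply: eq_bigr => j _.
rewrite expmxZ -[A ^+ _ * _]/(A ^+ (k - j) *m (t ^+ j *: B ^+ j)) -scalemxAr.
by rewrite -!scaler_nat -!scalemxAl !scalerA mulrC.
Qed.

Lemma monomials_eq0 (X Y Z : 'M[F]_n) k :
  X *m Y = Y *m X -> X *m Z = Z *m X -> Y *m Z = Z *m Y ->
  (forall a b, (Z + a *: X + b *: Y) ^+ k = 0) ->
  forall i j l, (i + j + l = k)%N -> X ^+ i *m Y ^+ j *m Z ^+ l = 0.
Proof.
move=> XY XZ YZ ZXY i j l ijl.
have ZX b : (Z + b *: Y) ^+ (k - i) *m X ^+ i *m 1%:M = 0.
  apply: polarize_mx; last by lia.
    by rewrite mulmxDl mulmxDr -scalemxAl -scalemxAr XY XZ.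
  by move=> a; rewrite mulmx1 -[RHS](ZXY a b) addrAC.
have := @polarize_mx Z Y (X ^+ i) (k - i) (esym YZ) _ j.
have -> : (k - i - j = l)%N by lia.
have cc (A B : 'M[F]_n) p q : A *m B = B *m A -> A ^+ p *m B ^+ q = B ^+ q *m A ^+ p.
  by move=> AB; apply/comm_expmx/esym/comm_expmx/esym.
move=> h; rewrite (cc X Y) // -mulmxA (cc X Z) // mulmxA (cc Y Z) //.
by apply: h; [move=> t; rewrite -[LHS]mulmx1 ZX | lia].
Qed.

End Polarization.

(** * Splitting along eigenvalues *)

Section DualBases.
Variable F : fieldType.

Lemma dual_bases n1 n2 n (B1 : 'M[F]_(n1, n)) (B2 : 'M[F]_(n2, n)) :
  (n1 + n2 = n)%N -> (1%:M <= B1 + B2)%MS ->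
  exists C1 C2, [/\ B1 *m C1 = 1%:M, B1 *m C2 = 0, B2 *m C1 = 0, B2 *m C2 = 1%:M
    & C1 *m B1 + C2 *m B2 = 1%:M].
Proof.
move=> e; case: n / e B1 B2 => B1 B2; rewrite addsmxE sub1mx row_full_unit => uB.
pose C := invmx (col_mx B1 B2); exists (lsubmx C), (rsubmx C).
have := mulmxV uB; have := mulVmx uB; rewrite -/C -{1 2}[C]hsubmxK mul_row_col => CB.
rewrite mul_col_row scalar_mx_block => /eq_block_mx [e1 e2 e3 e4].
by split; rewrite -?scalar_mx_block.
Qed.

End DualBases.

Section Splitting.
Variables (F : fieldType) (n : nat).

Section Blocks.
Variables (n1 n2 : nat) (B1 : 'M[F]_(n1, n)) (B2 : 'M[F]_(n2, n)).
Variables (C1 : 'M[F]_(n, n1)) (C2 : 'M[F]_(n, n2)).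
Hypotheses (B11 : B1 *m C1 = 1%:M) (B12 : B1 *m C2 = 0).
Hypotheses (B21 : B2 *m C1 = 0) (B22 : B2 *m C2 = 1%:M).
Hypothesis CB : C1 *m B1 + C2 *m B2 = 1%:M.

Definition blk (T : 'M[F]_n) : 'M_n1 := B1 *m T *m C1.

Lemma blkL T : (B1 *m T <= B1)%MS -> B1 *m T = blk T *m B1.
Proof. by move=> /submxP [D DE]; rewrite /blk DE -(mulmxA D) B11 mulmx1. Qed.

Lemma blkR T : (B1 *m T <= B1)%MS -> (B2 *m T <= B2)%MS -> T *m C1 = C1 *m blk T.
Proof.
move=> s1 /submxP [D DE].
have E2 : B2 *m (T *m C1) = 0 by rewrite mulmxA DE -mulmxA B21 mulmx0.
by rewrite -[LHS]mul1mx -CB mulmxDl -(mulmxA C2) E2 mulmx0 addr0 -(mulmxA C1) (mulmxA B1).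
Qed.

Lemma blkM S T : (B1 *m S <= B1)%MS -> blk (S *m T) = blk S *m blk T.
Proof. by move=> s1; rewrite {1}/blk mulmxA blkL // /blk -!mulmxA. Qed.

Lemma blk_comm S T : (B1 *m S <= B1)%MS -> (B1 *m T <= B1)%MS ->
  S *m T = T *m S -> blk S *m blk T = blk T *m blk S.
Proof. by move=> s1 t1 ST; rewrite -!blkM // ST. Qed.

Lemma blk_cyclic X Y Z v : cyclic_vector X Y Z v ->
  (B1 *m X <= B1)%MS -> (B1 *m Y <= B1)%MS -> (B1 *m Z <= B1)%MS ->
  (B2 *m X <= B2)%MS -> (B2 *m Y <= B2)%MS -> (B2 *m Z <= B2)%MS ->
  cyclic_vector (blk X) (blk Y) (blk Z) (v *m C1).
Proof.
move=> cyc X1 Y1 Z1 X2 Y2 Z2 W vW WX WY WZ.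
have st T : (B1 *m T <= B1)%MS -> (B2 *m T <= B2)%MS -> (W *m blk T <= W)%MS ->
    ((W *m B1 + B2)%MS *m T <= W *m B1 + B2)%MS.
  move=> T1 T2 WT; rewrite addsmxMr addsmx_sub; apply/andP; split.
    rewrite -mulmxA blkL // mulmxA; apply: submx_trans (addsmxSl _ _).
    by rewrite submxMr.
  by apply: submx_trans T2 (addsmxSr _ _).
have : (1%:M <= W *m B1 + B2)%MS.
  apply: cyc; try exact: st.
  rewrite -[v]mulmx1 -CB mulmxDr !mulmxA addmx_sub //.
    by apply: submx_trans (addsmxSl _ _); rewrite submxMr.
  by apply: submx_trans (addsmxSr _ _); rewrite submxMl.
move=> /(submxMr C1); rewrite mul1mx addsmxMr B21 addsmx0 -mulmxA B11 mulmx1 => C1W.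
by rewrite -B11; apply: submx_trans (submxMl _ _) C1W.
Qed.

Lemma blkX T j : (B1 *m T <= B1)%MS -> blk (T ^+ j) = blk T ^+ j.
Proof.
move=> T1; elim: j => [|j IHj]; first by rewrite !expr0 /blk mulmx1.
by rewrite !expmxS blkM // IHj.
Qed.

Definition offblk (T : 'M[F]_n) : 'M_(n1, n2) := B1 *m T *m C2.

Lemma blk_bracket S T : (B1 *m S <= B1)%MS -> (B2 *m S <= B2)%MS ->
  bracket (blk S) (blk T) = B1 *m bracket S T *m C1.
Proof.
move=> S1 S2; rewrite /bracket mulmxBr mulmxBl (mulmxA B1 S) blkL //.
by rewrite -(mulmxA B1 (T *m S)) -(mulmxA T) blkR // /blk !mulmxA.
Qed.

Lemma tangent_blk X Y Z w :
  (B1 *m X <= B1)%MS -> (B1 *m Y <= B1)%MS -> (B1 *m Z <= B1)%MS ->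
  (B2 *m X <= B2)%MS -> (B2 *m Y <= B2)%MS -> (B2 *m Z <= B2)%MS ->
  w \in tangent X Y Z ->
  ((blk w.1.1, blk w.1.2), blk w.2) \in tangent (blk X) (blk Y) (blk Z).
Proof.
move=> X1 Y1 Z1 X2 Y2 Z2 /tangentP [e1 e2 e3]; apply/tangentP => /=.
by rewrite !blk_bracket // e1 e2 e3.
Qed.

End Blocks.

(** Iterating the relation gives [A ^+ m *m G = G *m B ^+ m], with zero on the left and an
    invertible factor on the right. *)
Lemma sylvester_eq0 n1 n2 (A : 'M[F]_n1) (B : 'M[F]_n2) (G : 'M_(n1, n2)) m :
  A ^+ m = 0 -> B ^+ m \in unitmx -> A *m G = G *m B -> G = 0.
Proof.
move=> Am Bm AG; have : A ^+ m *m G = G *m B ^+ m.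
  elim: m {Am Bm} => [|m IHm]; first by rewrite !expr0 mul1mx mulmx1.
  by rewrite expmxSr -mulmxA AG mulmxA IHm -mulmxA -expmxSr.
rewrite Am mul0mx => /(congr1 (mulmx^~ (invmx (B ^+ m)))).
by rewrite mul0mx -mulmxA mulmxV // mulmx1.
Qed.

Lemma sylvester_eq0' n1 n2 (A : 'M[F]_n1) (B : 'M[F]_n2) (G : 'M_(n2, n1)) m :
  A ^+ m = 0 -> B ^+ m \in unitmx -> B *m G = G *m A -> G = 0.
Proof.
move=> Am Bm BG; have : B ^+ m *m G = G *m A ^+ m.
  elim: m {Am Bm} => [|m IHm]; first by rewrite !expr0 mul1mx mulmx1.
  by rewrite expmxSr -mulmxA BG mulmxA IHm -mulmxA -expmxSr.
rewrite Am mulmx0 => /(congr1 (mulmx (invmx (B ^+ m)))).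
by rewrite mulmx0 mulmxA mulVmx // mul1mx.
Qed.

Lemma offblk_bracket n1 n2 (B1 : 'M[F]_(n1, n)) (B2 : 'M[F]_(n2, n))
    (C1 : 'M[F]_(n, n1)) (C2 : 'M[F]_(n, n2)) S T :
  B1 *m C1 = 1%:M -> B2 *m C2 = 1%:M -> B1 *m C2 = 0 ->
  C1 *m B1 + C2 *m B2 = 1%:M ->
  (B1 *m S <= B1)%MS -> (B2 *m S <= B2)%MS ->
  B1 *m bracket S T *m C2 =
    blk B1 C1 S *m offblk B1 C2 T - offblk B1 C2 T *m blk B2 C2 S.
Proof.
move=> B11 B22 B12 CB S1 S2; rewrite /bracket mulmxBr mulmxBl (mulmxA B1 S).
rewrite (blkL B11) // -(mulmxA B1 (T *m S)) -(mulmxA T).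
have CB' : C2 *m B2 + C1 *m B1 = 1%:M by rewrite addrC.
by rewrite (blkR B12 CB') // /offblk /blk !mulmxA.
Qed.

Section Fitting.
Variables (X Y Z : 'M[F]_n) (v : 'rV[F]_n) (lambda : F) (m : nat).
Hypotheses (XY : X *m Y = Y *m X) (XZ : X *m Z = Z *m X) (YZ : Y *m Z = Z *m Y).
Hypothesis cyc : cyclic_vector X Y Z v.
Hypothesis IH : forall m (X Y Z : 'M[F]_m) (v : 'rV[F]_m), (m < n)%N ->
  X *m Y = Y *m X -> X *m Z = Z *m X -> Y *m Z = Z *m Y -> cyclic_vector X Y Z v ->
  (\dim (tangent X Y Z) + m <= m ^ 2 + maxT m)%N.
Let M := X - lambda%:M.
Hypothesis stable_rank : (\rank (M ^+ m) <= \rank (M ^+ (m + m)))%N.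
Hypotheses (rank_gt0 : (0 < \rank (M ^+ m))%N) (rank_lt : (\rank (M ^+ m) < n)%N).

(** In the Fitting decomposition for [M], the diagonal blocks of a tangent vector are tangent to the
    two smaller triples, and its off-diagonal blocks are determined by those of the first component,
    which cost 2 n1 n2. This is the cross term of n^2, and [maxT_superadd] makes the bound
    strict. *)
Lemma split_bound : (\dim (tangent X Y Z) + n < n ^ 2 + maxT n)%N.
Proof.
have commM T : X *m T = T *m X -> M *m T = T *m M.
  by move=> XT; rewrite /M mulmxBl mulmxBr XT scalar_mxC.
have XM : X *m M = M *m X by rewrite commM.
pose U1 := kermx (M ^+ m); pose U2 := M ^+ m.
have rU : (\rank U1 + \rank U2 = n)%N by rewrite mxrank_ker subnK // rank_leq_col.
have U12 : (1%:M <= row_base U1 + row_base U2)%MS.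
  rewrite sub1mx -col_leq_rank (adds_eqmx (eq_row_base _) (eq_row_base _)).
  have := mxrank_sum_cap U1 U2; rewrite rU.
  have := mxrank_mul_ker U2 (M ^+ m); rewrite capmxC -/U1 -[U2 *m _]exprD.
  by move: stable_rank; rewrite -/U2; rank_lia.
have [C1 [C2 [B11 B12 B21 B22 CB]]] := dual_bases rU U12.
set B1 := row_base U1 in B11 B12 B21 B22 CB; set B2 := row_base U2 in B11 B12 B21 B22 CB.
have CB' : C2 *m B2 + C1 *m B1 = 1%:M by rewrite addrC.
have st1 T : X *m T = T *m X -> (B1 *m T <= B1)%MS.
  move=> /commM MT; rewrite eq_row_base.
  have : (B1 <= U1)%MS by rewrite eq_row_base.
  rewrite sub_kermx => /eqP B1M; apply/sub_kermxP.
  by rewrite -mulmxA -comm_expmx // mulmxA B1M mul0mx.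
have st2 T : X *m T = T *m X -> (B2 *m T <= B2)%MS.
  move=> /commM MT; rewrite eq_row_base.
  apply: submx_trans (submxMr _ (_ : B2 <= U2)%MS) _; first by rewrite eq_row_base.
  by rewrite comm_expmx // submxMl.
have A1m : blk B1 C1 M ^+ m = 0.
  rewrite -(blkX B11) ?(st1 _ XM) //.
  rewrite /blk; suff -> : B1 *m M ^+ m = 0 by rewrite mul0mx.
  by apply/sub_kermxP; rewrite eq_row_base.
have A2m : blk B2 C2 M ^+ m \in unitmx.
  rewrite -(blkX B22) ?(st2 _ XM) //.
  rewrite -row_free_unit -row_leq_rank.
  have s2 : (B2 *m M ^+ m <= B2)%MS by apply/st2/esym/comm_expmx/esym.
  apply: leq_trans (_ : \rank (B2 *m M ^+ m) <= _)%N; last first.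
    by rewrite (blkL B22 s2) mxrankM_maxl.
  rewrite (eqmxMr _ (eq_row_base U2)) -[U2 *m _]exprD.
  exact: stable_rank.
pose d1 := tangent (blk B1 C1 X) (blk B1 C1 Y) (blk B1 C1 Z).
pose d2 := tangent (blk B2 C2 X) (blk B2 C2 Y) (blk B2 C2 Z).
(* Once the first component is block diagonal, the off-diagonal blocks of the others intertwine a
   nilpotent and an invertible operator. *)
have offdiag (w : triple F n) : w \in tangent X Y Z ->
    offblk B1 C2 w.1.1 = 0 -> offblk B2 C1 w.1.1 = 0 ->
    [/\ offblk B1 C2 w.1.2 = 0, offblk B1 C2 w.2 = 0,
        offblk B2 C1 w.1.2 = 0 & offblk B2 C1 w.2 = 0].
  move=> /tangentP [e1 e2 e3] o12 o21.
  have o T T' : X *m T = T *m X -> bracket X T' = bracket T w.1.1 ->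
      offblk B1 C2 T' = 0 /\ offblk B2 C1 T' = 0.
    move=> XT; rewrite -(bracket_scalar X T' lambda) -/M => MT'; split.
      apply: (sylvester_eq0 A1m A2m); apply/eqP; rewrite -subr_eq0; apply/eqP.
      rewrite -(offblk_bracket _ B11 B22 B12 CB) ?(st1 _ XM) ?(st2 _ XM) // MT'.
      by rewrite (offblk_bracket _ B11 B22 B12 CB) ?st1 ?st2 // o12 mulmx0 mul0mx subrr.
    apply: (sylvester_eq0' A1m A2m); apply/eqP; rewrite -subr_eq0; apply/eqP.
    rewrite -(offblk_bracket _ B22 B11 B21 CB') ?(st1 _ XM) ?(st2 _ XM) // MT'.
    by rewrite (offblk_bracket _ B22 B11 B21 CB') ?st1 ?st2 // o21 mulmx0 mul0mx subrr.
  by have [-> ->] := o Y w.1.2 XY e3; have [-> ->] := o Z w.2 XZ (esym e2).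
pose n1 := \rank U1; pose n2 := \rank U2.
have [K1 K1E] : exists K : {vspace triple F n}, forall w, w \in K <->
    [/\ w \in tangent X Y Z, offblk B1 C2 w.1.1 = 0 & offblk B2 C1 w.1.1 = 0].
  apply: pred_vspace => [|a u w [u0 u1 u2] [w0 w1 w2]].
    by rewrite mem0v /offblk !mulmx0 !mul0mx.
  rewrite memvD ?memvZ //; move: u1 u2 w1 w2; rewrite /offblk /= => u1 u2 w1 w2.
  rewrite !mulmxDr !mulmxDl -!scalemxAr -!scalemxAl.
  by rewrite u1 u2 w1 w2 !scaler0 !addr0.
have [K2 K2E] : exists K : {vspace triple F n}, forall w, w \in K <->
    [/\ w \in K1, blk B1 C1 w.1.1 = 0, blk B1 C1 w.1.2 = 0 & blk B1 C1 w.2 = 0].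
  apply: pred_vspace => [|a u w [u0 u1 u2 u3] [w0 w1 w2 w3]].
    by rewrite mem0v /blk !mulmx0 !mul0mx.
  rewrite memvD ?memvZ //; move: u1 u2 u3 w1 w2 w3; rewrite /blk /= => u1 u2 u3 w1 w2 w3.
  rewrite !mulmxDr !mulmxDl -!scalemxAr -!scalemxAl.
  by rewrite u1 u2 u3 w1 w2 w3 !scaler0 !addr0.
have leK1 : (\dim (tangent X Y Z) <= \dim K1 + 2 * (n1 * n2))%N.
  have -> : (2 * (n1 * n2))%N = dim ('M[F]_(n1, n2) * 'M[F]_(n2, n1))%type.
    by rewrite -[RHS]/(n1 * n2 + n2 * n1)%N; lia.
  apply: (@dim_ker_le _ _ _ (fun w : triple F n => (offblk B1 C2 w.1.1, offblk B2 C1 w.1.1))).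
    by move=> a u w; rewrite /offblk /= !mulmxDr !mulmxDl -!scalemxAr -!scalemxAl.
  by move=> w wT [w1 w2]; apply/K1E.
have leK2 : (\dim K1 <= \dim K2 + \dim d1)%N.
  apply: (@dim_ker_image_le _ _ _ (fun w : triple F n =>
    (((blk B1 C1 w.1.1, blk B1 C1 w.1.2), blk B1 C1 w.2) : triple F n1))).
  - by move=> a u w; rewrite /blk /= !mulmxDr !mulmxDl -!scalemxAr -!scalemxAl.
  - move=> w /K1E [wT _ _]; apply: (tangent_blk B11 B21 CB) => //; by rewrite ?st1 ?st2.
  - by move=> w wK [w1 w2 w3]; apply/K2E.
have leK3 : (\dim K2 <= \dim d2)%N.
  apply: (@dim_inj_le _ _ _ (fun w : triple F n =>
    (((blk B2 C2 w.1.1, blk B2 C2 w.1.2), blk B2 C2 w.2) : triple F n2))).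
  - by move=> a u w; rewrite /blk /= !mulmxDr !mulmxDl -!scalemxAr -!scalemxAl.
  - move=> w /K2E [/K1E [wT o12 o21] w11 w12 w13] [w21 w22 w23].
    have [o1 o2 o3 o4] := offdiag w wT o12 o21.
    have T0 T : blk B1 C1 T = 0 -> blk B2 C2 T = 0 -> offblk B1 C2 T = 0 ->
        offblk B2 C1 T = 0 -> T = 0.
      rewrite /blk /offblk => t1 t2 t3 t4.
      rewrite -[T]mul1mx -[_ *m T]mulmx1 -CB !mulmxDr !mulmxDl.
      have E k1 k2 (C : 'M_(n, k1)) (B : 'M_(k1, n)) (C' : 'M_(n, k2)) (B' : 'M_(k2, n)) :
          B *m T *m C' = 0 -> C *m B *m T *m (C' *m B') = 0.
        by move=> BT; rewrite !mulmxA -(mulmxA C) -(mulmxA C) BT mulmx0 mul0mx.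
      by rewrite !E // !addr0.
    case: w wT o12 o21 w11 w12 w13 w21 w22 w23 o1 o2 o3 o4 => [[A B] C] /= *.
    by rewrite (T0 A) // (T0 B) // (T0 C).
  - move=> w /K2E [/K1E [wT _ _] _ _ _]; apply: (tangent_blk B22 B12 CB') => //; by rewrite ?st1 ?st2.
have n1n : (n1 < n)%N by rewrite -rU -/n1 -[X in (X < _)%N]addn0 ltn_add2l.
have n2n : (n2 < n)%N by [].
have bd1 : (\dim d1 + n1 <= n1 ^ 2 + maxT n1)%N.
  apply: IH n1n _ _ _ (blk_cyclic B11 B21 CB cyc _ _ _ _ _ _);
    do ?[exact: st1 | exact: st2].
  - exact: (blk_comm B11 (st1 _ erefl) (st1 _ XY) XY).
  - exact: (blk_comm B11 (st1 _ erefl) (st1 _ XZ) XZ).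
  - exact: (blk_comm B11 (st1 _ XY) (st1 _ XZ) YZ).
have bd2 : (\dim d2 + n2 <= n2 ^ 2 + maxT n2)%N.
  apply: IH n2n _ _ _ (blk_cyclic B22 B12 CB' cyc _ _ _ _ _ _);
    do ?[exact: st2 | exact: st1].
  - exact: (blk_comm B22 (st2 _ erefl) (st2 _ XY) XY).
  - exact: (blk_comm B22 (st2 _ erefl) (st2 _ XZ) XZ).
  - exact: (blk_comm B22 (st2 _ XY) (st2 _ XZ) YZ).
have n1_gt0 : (0 < n1)%N by move: rU n2n; rewrite -/n1 -/n2; lia.
have sup : (maxT n1 + maxT n2 < maxT (n1 + n2))%N := maxT_superadd n1_gt0 rank_gt0.
have nE : (n1 + n2 = n)%N := rU.
have : (n ^ 2 = n1 ^ 2 + n2 ^ 2 + 2 * (n1 * n2))%N by rewrite -nE; lia.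
by move: sup; rewrite nE; lia.
Qed.

End Fitting.

End Splitting.

Section Global.
Variable F : numClosedFieldType.

Lemma stable_eigenvalue n (X : 'M[F]_n) : (0 < n)%N ->
  exists a m, let M := X - a%:M in
    (\rank (M ^+ m) < n)%N /\ forall j, (\rank (M ^+ m) <= \rank (M ^+ j))%N.
Proof.
move=> n_gt0.
have /closed_rootP [a] : size (char_poly X) != 1%N.
  by rewrite size_char_poly; case: (n) n_gt0.
rewrite -eigenvalue_root_char /eigenvalue /eigenspace => ka.
pose M := X - a%:M; pose D d := `[< exists m, \rank (M ^+ m) = d >].
have exD : exists d, D d by exists (\rank (M ^+ 0)); apply/asboolP; exists 0%N.
case: (ex_minnP exD) => d /asboolP [m md] min_d.
have minM j : (\rank (M ^+ m) <= \rank (M ^+ j))%N.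
  by rewrite md; apply: min_d; apply/asboolP; exists j.
exists a, m; split => //; apply: leq_ltn_trans (minM 1%N) _; rewrite expr1.
by move: ka; rewrite -mxrank_eq0 mxrank_ker -lt0n subn_gt0.
Qed.

Lemma cyclic_rot n (X Y Z : 'M[F]_n) v : cyclic_vector X Y Z v -> cyclic_vector Y Z X v.
Proof. by move=> cyc W vW WY WZ WX; apply: cyc. Qed.

Lemma cyclic_translate n (X Y Z : 'M[F]_n) v p q r : cyclic_vector X Y Z v ->
  cyclic_vector (X - p%:M) (Y - q%:M) (Z - r%:M) v.
Proof.
move=> cyc W vW WX WY WZ.
have st T a : (W *m (T - a%:M) <= W)%MS -> (W *m T <= W)%MS.
  move=> WT; rewrite -[T](subrK a%:M) mulmxDr addmx_sub // mul_mx_scalar.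
  exact: scalemx_sub.
by apply: cyc => //; [apply: st WX | apply: st WY | apply: st WZ].
Qed.

Lemma global_bound n (X Y Z : 'M[F]_n) v :
  X *m Y = Y *m X -> X *m Z = Z *m X -> Y *m Z = Z *m Y -> cyclic_vector X Y Z v ->
  (\dim (tangent X Y Z) + n <= n ^ 2 + maxT n)%N /\
  forall k, (0 < k)%N -> n = tet k ->
    (\dim (tangent X Y Z) + n)%N = (n ^ 2 + maxT n)%N ->
    exists p q r, forall i j l, (i + j + l = k)%N ->
      (X - p%:M) ^+ i *m (Y - q%:M) ^+ j *m (Z - r%:M) ^+ l = 0.
Proof.
elim/ltn_ind: n X Y Z v => n IH X Y Z v XY XZ YZ cyc.
case: (posnP n) => [n0|n_gt0].
  split=> [|k k_gt0 nk]; last by have := leq_tet k; lia.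
  have : (\dim (tangent X Y Z) <= dim (triple F n))%N by rewrite -dimvf dimvS ?subvf.
  by rewrite dim_triple; move: (\dim _) => d; rewrite n0; lia.
have IH' m (X' Y' Z' : 'M[F]_m) (v' : 'rV[F]_m) : (m < n)%N ->
    X' *m Y' = Y' *m X' -> X' *m Z' = Z' *m X' -> Y' *m Z' = Z' *m Y' ->
    cyclic_vector X' Y' Z' v' ->
    (\dim (tangent X' Y' Z') + m <= m ^ 2 + maxT m)%N.
  by move=> lt_mn xy xz yz c; have [] := IH m lt_mn _ _ _ _ xy xz yz c.
have [|big_gap] := ltnP (\dim (tangent X Y Z) + n) (n ^ 2 + maxT n).
  by move=> lt; split=> [|k _ _ e]; [apply: ltnW | move: lt; rewrite e ltnn].
(* When the bound is attained, [split_bound] leaves the first operator a single eigenvalue; rotating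
   the triple gives the same for the other two. *)
have nilp (X' Y' Z' : 'M[F]_n) : X' *m Y' = Y' *m X' -> X' *m Z' = Z' *m X' ->
    Y' *m Z' = Z' *m Y' -> cyclic_vector X' Y' Z' v ->
    (\dim (tangent X Y Z) <= \dim (tangent X' Y' Z'))%N ->
    exists a m, (X' - a%:M) ^+ m = 0.
  move=> XY' XZ' YZ' cyc' le_dim.
  have [a [m [rk_lt rk_min]]] := stable_eigenvalue X' n_gt0; exists a, m.
  apply/eqP; rewrite -mxrank_eq0 -leqn0 leqNgt; apply/negP => rk_gt0.
  have := @split_bound _ _ X' Y' Z' v a m XY' XZ' YZ' cyc' IH' (rk_min _) rk_gt0 rk_lt.
  by move: big_gap le_dim; lia.
have rot1 := dim_tangent_rot X Y Z; have rot2 := leq_trans rot1 (dim_tangent_rot Y Z X).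
have cyc1 := cyclic_rot cyc; have cyc2 := cyclic_rot cyc1.
have [p [N1 Xp]] := nilp X Y Z XY XZ YZ cyc (leqnn _).
have [q [N2 Yq]] := nilp Y Z X YZ (esym XY) (esym XZ) cyc1 rot1.
have [r [N3 Zr]] := nilp Z X Y (esym XZ) (esym YZ) XY cyc2 rot2.
pose N := (N1 + N2 + N3)%N.
have [le1 le2 le3] : [/\ N1 <= N, N2 <= N & N3 <= N]%N by rewrite /N; split; lia.
have comm_tr (A B : 'M[F]_n) a b : A *m B = B *m A ->
    (A - a%:M) *m (B - b%:M) = (B - b%:M) *m (A - a%:M).
  move=> AB; rewrite !mulmxBl !mulmxBr AB !mul_scalar_mx !mul_mx_scalar !opprB.
  rewrite !addrA; apply/matrixP => i j; rewrite !mxE; ring.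
have [bound eqcase] := @local_bound F n N (X - p%:M) (Y - q%:M) (Z - r%:M) v
  (comm_tr _ _ _ _ XY) (comm_tr _ _ _ _ XZ) (comm_tr _ _ _ _ YZ)
  (expmx_nil Xp le1) (expmx_nil Yq le2)
  (expmx_nil Zr le3) (cyclic_translate cyc).
rewrite tangent_translate in bound eqcase.
split=> // k k_gt0 nk e; exists p, q, r.
exact: (monomials_eq0 (comm_tr _ _ _ _ XY) (comm_tr _ _ _ _ XZ)
  (comm_tr _ _ _ _ YZ) (eqcase k nk e)).
Qed.

End Global.

Local Open Scope quotient_scope.

(** * From ideals to commuting triples *)

Section QuotientMap.
Variables (A : comNzRingType) (J : ideal A).

Definition qpi (f : A) : quotmod J := \pi_{ideal_quot (submodule_pred J)} (f : A^o).

Lemma qpi_is_linear a (f g : A) : qpi (a * f + g) = a *: qpi f + qpi g.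
Proof.
by rewrite /qpi [LHS](raddfD (\pi_{ideal_quot (submodule_pred J)})); congr (_ + _); apply: pi_scale.
Qed.

Lemma qpiD f g : qpi (f + g) = qpi f + qpi g.
Proof. by have := qpi_is_linear 1 f g; rewrite mul1r scale1r. Qed.

Lemma qpi_eq0 f : qpi f = 0 <-> f \in J.
Proof.
split=> [/eqP|fJ]; last apply/eqP; rewrite -[0](raddf0 (\pi_{ideal_quot (submodule_pred J)})).
  by rewrite -Quotient.idealrBE subr0.
by rewrite -Quotient.idealrBE subr0.
Qed.

Lemma qpi0 : qpi 0 = 0.
Proof. by apply/qpi_eq0; apply: rpred0. Qed.

Lemma qpiM a f : qpi (a * f) = a *: qpi f.
Proof. by have := qpi_is_linear a f 0; rewrite !addr0 qpi0 addr0. Qed.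

Lemma qpiB f g : qpi (f - g) = qpi f - qpi g.
Proof. by apply/eqP; rewrite eq_sym subr_eq -qpiD subrK. Qed.

Lemma qpi_surj x : exists f, x = qpi f.
Proof. by exists (repr x); rewrite /qpi reprK. Qed.

Lemma qpi_ann f x : f \in J -> f *: x = 0 :> quotmod J.
Proof.
move=> fJ; have [g ->] := qpi_surj x; rewrite -qpiM; apply/qpi_eq0.
by rewrite mulrC; apply: (rpredZ g).
Qed.

Lemma idealZ a f : f \in J -> a * f \in J.
Proof. by move=> fJ; apply: (rpredZ a). Qed.

End QuotientMap.

Section HomEval.
Variables (A : comNzRingType) (M N : lmodType A).

Lemma hom_linear (phi : Defs.hom M N) : linear (submod_val phi).
Proof. by case: phi => f fP /=; move: fP; rewrite unfold_in => /asboolP. Qed.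

Lemma hom_eqP (phi psi : Defs.hom M N) :
  (forall x, submod_val phi x = submod_val psi x) -> phi = psi.
Proof. by move=> e; apply/val_inj/funext. Qed.

Definition mk_hom (f : M -> N) (lf : linear f) : Defs.hom M N :=
  @Submod _ _ (Submodule (is_hom_closed M N)) f (introT (asboolP (linear f)) lf).

End HomEval.

Section Dimension.
Variable K : fieldType.

Lemma is_dim_ge (V : lmodType K) (W : vectType K) (f : W -> V) t :
  is_dim V t -> linear f -> injective f -> (dim W <= t)%N.
Proof.
move=> [[g glin [g' gK g'K]]] flin finj.
rewrite -dimvf; have -> : t = \dim {:'rV[K]_t} by rewrite dimvf [RHS]mul1n.
apply: (@dim_inj_le _ _ _ (g \o f)).
- by move=> a u v /=; rewrite flin glin.
- move=> u _ /= fu; apply: finj; apply: (can_inj gK); rewrite fu.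
  have lin0 (V' : lmodType K) (W' : lmodType K) (h : V' -> W') : linear h -> h 0 = 0.
    by move=> hlin; have := hlin (-1) 0 0; rewrite scaler0 addr0 scaleN1r addNr.
  by rewrite (lin0 _ _ _ flin) (lin0 _ _ _ glin).
- by move=> u _; rewrite memvf.
Qed.

Lemma is_dim_uniq (V : lmodType K) t t' : is_dim V t -> is_dim V t' -> t = t'.
Proof.
have aux a b : is_dim V a -> is_dim V b -> (a <= b)%N.
  move=> [[g glin [g' gK g'K]]] bV.
  have -> : a = dim 'rV[K]_a by rewrite [RHS]mul1n.
  apply: (is_dim_ge bV (f := g')).
    by move=> c u v; apply: (can_inj gK); rewrite glin !g'K.
  exact: can_inj g'K.
by move=> ta tb; apply/eqP; rewrite eqn_leq !aux.
Qed.

(** Finite dimension of [V] is part of the conclusion: coordinates on the image are transported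
    back. *)
Lemma is_dim_inj (V : lmodType K) (W : vectType K) (f : V -> W) :
  linear f -> injective f ->
  exists U : {vspace W}, is_dim V (\dim U) /\ forall w, w \in U <-> exists v, w = f v.
Proof.
move=> flin finj.
have [U UE] : exists U : {vspace W}, forall w, w \in U <-> exists v, w = f v.
  apply: pred_vspace => [|a _ _ [u ->] [v ->]]; last by exists (a *: u + v); rewrite flin.
  by exists 0; have := flin (-1) 0 0; rewrite scaler0 addr0 scaleN1r addNr.
exists U; split=> //; constructor.
have fU v : f v \in U by apply/UE; exists v.
pose g v : 'rV[K]_(\dim U) := \row_i coord (vbasis U) i (f v).
exists g => [a u v|].
  by apply/rowP => i; rewrite !mxE flin linearP.
pose h (r : 'rV[K]_(\dim U)) : W := \sum_i r 0 i *: (vbasis U)`_i.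
have hU r : h r \in U.
  by apply: memv_suml => i _; rewrite memvZ // vbasis_mem // mem_nth // size_tuple.
have hex r : exists v, h r = f v by apply/UE.
exists (fun r => projT1 (cid (hex r))) => [v|r].
  apply: finj; case: cid => w /= <-; rewrite /h.
  by rewrite [in RHS](coord_vbasis (fU v)); apply: eq_bigr => i _; rewrite mxE.
apply/rowP => i; rewrite mxE; case: cid => w /= <-.
by rewrite /h coord_sum_free // (basis_free (vbasisP U)).
Qed.

End Dimension.

Lemma mpoly_ind_gen (F : fieldType) n (Q : {mpoly F[n]} -> Prop) : Q 1 ->
  (forall c f g, Q f -> Q g -> Q (c *: f + g)) ->
  (forall i f, Q f -> Q ('X_i * f)) -> forall f, Q f.
Proof.
move=> Q1 Qlin QX; have Q0 : Q 0 by have := Qlin (-1) _ _ Q1 Q1; rewrite scaleN1r addNr.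
elim/mpolyind => [//|c m p _ _ Qp]; apply: Qlin => //.
rewrite mpolyXE_id; elim/big_rec: _ => [//|i f _ Qf].
by elim: (m i) => [|k IHk]; rewrite ?expr0 ?mul1r // exprS -mulrA; apply: QX.
Qed.

Section TangentSpace.
Variables (F : numClosedFieldType) (l : nat) (J : ideal {mpoly F[3]}).
Local Notation P := {mpoly F[3]}.
Variable vr : quotmod J -> 'rV[F]_l.
Hypothesis vr_lin : forall (c : F) x y, vr ((c%:A : P) *: x + y) = c *: vr x + vr y.
Hypothesis vr_inj : injective vr.
Hypothesis vr_surj : forall u, exists x, vr x = u.

Definition ev (f : P) : 'rV[F]_l := vr (qpi J f).

Lemma ev_lin c f g : ev (c *: f + g) = c *: ev f + ev g.
Proof. by rewrite /ev qpiD -mulr_algl qpiM vr_lin. Qed.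

Let vr0 : vr 0 = 0.
Proof. by have := vr_lin (-1) 0 0; rewrite scaler0 addr0 scaleN1r addNr. Qed.

Lemma ev_eq0 f : ev f = 0 <-> f \in J.
Proof.
rewrite -qpi_eq0 /ev; split=> [|->]; last exact: vr0.
by rewrite -vr0 => /vr_inj.
Qed.

Lemma ev_surj u : exists f, ev f = u.
Proof. by have [x <-] := vr_surj u; have [f ->] := qpi_surj x; exists f. Qed.

Definition basis_lift (j : 'I_l) : P := projT1 (cid (ev_surj (delta_mx 0 j))).

Lemma ev_basis_lift j : ev (basis_lift j) = delta_mx 0 j.
Proof. by rewrite /basis_lift; case: cid. Qed.

Definition sec (u : 'rV[F]_l) : P := \sum_j u 0 j *: basis_lift j.

Lemma lin_sec (h : P -> 'rV[F]_l) u : (forall c f g, h (c *: f + g) = c *: h f + h g) ->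
  h (sec u) = u *m \matrix_(j, k) h (basis_lift j) 0 k.
Proof.
move=> hlin; rewrite mulmx_sum_row /sec.
have h0 : h 0 = 0 by have := hlin (-1) 0 0; rewrite scaler0 addr0 scaleN1r addNr.
apply: (big_rec2 (fun f w => h f = w)) => [//|j w f _ <-].
rewrite hlin; congr (_ *: _ + _); apply/rowP => k; by rewrite !mxE.
Qed.

Lemma ev_sec u : ev (sec u) = u.
Proof.
rewrite (lin_sec _ ev_lin) -[RHS]mulmx1; congr (_ *m _).
by apply/matrixP => j k; rewrite mxE ev_basis_lift !mxE eqxx eq_sym.
Qed.

Lemma sec_lin c u w : sec (c *: u + w) = c *: sec u + sec w.
Proof.
rewrite /sec scaler_sumr -big_split; apply: eq_bigr => j _ /=.
by rewrite !mxE scalerDl scalerA.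
Qed.

Definition res (f : P) : P := f - sec (ev f).

Lemma resP f : res f \in J.
Proof.
apply/ev_eq0; rewrite /res addrC -scaleN1r ev_lin ev_sec scaleN1r.
exact: addNr.
Qed.

Lemma res_lin c f g : res (c *: f + g) = c *: res f + res g.
Proof. by rewrite /res ev_lin sec_lin scalerBr opprD addrACA. Qed.

Definition mult_mx i : 'M[F]_l := \matrix_(j, k) ev ('X_i * basis_lift j) 0 k.

Let mulX_lin (h : P -> 'rV[F]_l) i : (forall c f g, h (c *: f + g) = c *: h f + h g) ->
  forall c f g, h ('X_i * (c *: f + g)) = c *: h ('X_i * f) + h ('X_i * g).
Proof. by move=> hlin c f g; rewrite mulrDr -scalerAr hlin. Qed.

Lemma mult_mxE i u : u *m mult_mx i = ev ('X_i * sec u).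
Proof. by rewrite (@lin_sec (fun f => ev ('X_i * f))) //; apply: mulX_lin ev_lin. Qed.

Lemma ev_mul i f : ev ('X_i * f) = ev f *m mult_mx i.
Proof.
rewrite mult_mxE -{1}[f](subrK (sec (ev f))) -/(res f) mulrDr -[_ * res f]scale1r ev_lin.
by rewrite (iffRL (ev_eq0 _) (idealZ _ (resP f))) scaler0 add0r.
Qed.

Let vr_mul i x : vr (('X_i : P) *: x) = vr x *m mult_mx i.
Proof. by have [f ->] := qpi_surj x; rewrite -qpiM -ev_mul. Qed.

Lemma mult_mx_comm i j : mult_mx i *m mult_mx j = mult_mx j *m mult_mx i.
Proof.
apply/row_matrixP => a; rewrite !rowE !mulmxA.
have [f <-] := ev_surj (delta_mx 0 a).
by rewrite -!ev_mul !mulrA ['X_j * _]mulrC.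
Qed.

Lemma ev1_cyclic (W : 'M[F]_l) : (ev 1 <= W)%MS ->
  (forall i, (W *m mult_mx i <= W)%MS) -> (1%:M <= W)%MS.
Proof.
move=> W1 WX; apply/rV_subP => u _; have [f <-] := ev_surj u.
elim/mpoly_ind_gen: f => [//|c f g fW gW|i f fW].
  by rewrite ev_lin addmx_sub // scalemx_sub.
by rewrite ev_mul (submx_trans (submxMr _ fW)).
Qed.

Section OneHom.
Variable phi : Defs.hom (submod J) (quotmod J).

(* For the deformation of J defined by [phi], [psi] is the first order part of the
   reduction to normal form with respect to the section [sec]. *)
Definition psi (f : P) : 'rV[F]_l := vr (submod_val phi (Submod (resP f))).

Lemma psi_lin c f g : psi (c *: f + g) = c *: psi f + psi g.
Proof.
rewrite /psi -vr_lin -hom_linear; congr (vr (submod_val phi _)); apply/val_inj.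
by rewrite /= res_lin -[c *: res f]mulr_algl.
Qed.

Let psiD f g : psi (f + g) = psi f + psi g.
Proof. by have := psi_lin 1 f g; rewrite !scale1r. Qed.

Let phi0 : submod_val phi 0 = 0.
Proof. by have := hom_linear phi (-1) 0 0; rewrite scaler0 addr0 scaleN1r addNr. Qed.

Let sec0 : sec 0 = 0.
Proof. by have := sec_lin (-1) 0 0; rewrite scaler0 addr0 scaleN1r addNr. Qed.

Lemma psi_sec u : psi (sec u) = 0.
Proof.
rewrite /psi; have -> : Submod (resP (sec u)) = 0 by apply/val_inj; rewrite /= /res ev_sec subrr.
by rewrite phi0 vr0.
Qed.

Lemma psi_ideal f (fJ : f \in J) : psi f = vr (submod_val phi (Submod fJ)).
Proof.
rewrite /psi; congr (vr (submod_val phi _)); apply/val_inj => /=.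
by rewrite /res (iffRL (ev_eq0 f) fJ) sec0 subr0.
Qed.

Lemma psi_mul i f : f \in J -> psi ('X_i * f) = psi f *m mult_mx i.
Proof.
move=> fJ; rewrite (psi_ideal fJ) (psi_ideal (idealZ 'X_i fJ)) -vr_mul.
have hZ a x : submod_val phi (a *: x) = a *: submod_val phi x.
  by have := hom_linear phi a x 0; rewrite phi0 !addr0.
by rewrite -hZ; congr (vr (submod_val phi _)); apply/val_inj.
Qed.

Lemma psi_ann f g : f \in J -> g \in J -> psi (f * g) = 0.
Proof.
move=> fJ gJ; rewrite (psi_ideal (idealZ f gJ)).
have hZ a x : submod_val phi (a *: x) = a *: submod_val phi x.
  by have := hom_linear phi a x 0; rewrite phi0 !addr0.
have -> : Submod (idealZ f gJ) = f *: Submod gJ by apply/val_inj.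
by rewrite hZ qpi_ann.
Qed.

Lemma psi_res f : psi (res f) = psi f.
Proof. by have := psiD (res f) (sec (ev f)); rewrite subrK psi_sec addr0. Qed.

Definition tangent_mx i : 'M[F]_l := \matrix_(j, k) psi ('X_i * basis_lift j) 0 k.

Lemma tangent_mxE i u : u *m tangent_mx i = psi ('X_i * sec u).
Proof. by rewrite (@lin_sec (fun f => psi ('X_i * f))) //; apply: mulX_lin psi_lin. Qed.

(** Split [f] into its normal form and its remainder in [J]. This is a Leibniz rule in which
    [tangent_mx i] is the first order change of [mult_mx i]. *)
Lemma psi_mulX i f : psi ('X_i * f) = ev f *m tangent_mx i + psi f *m mult_mx i.
Proof.
have -> : 'X_i * f = 'X_i * sec (ev f) + 'X_i * res f by rewrite -mulrDr addrC subrK.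
by rewrite psiD (psi_mul i (resP f)) psi_res tangent_mxE.
Qed.

(** Expand [psi] on ['X_i * ('X_j * sec u)] by [psi_mulX] in both orders of the variables. *)
Lemma tangent_mx_comm i j :
  bracket (mult_mx i) (tangent_mx j) = bracket (mult_mx j) (tangent_mx i).
Proof.
apply/row_matrixP => a; rewrite !rowE; set u := delta_mx 0 a.
rewrite /bracket !mulmxBr !mulmxA.
have := psi_mulX j ('X_i * sec u); rewrite mulrCA !psi_mulX !ev_mul ev_sec psi_sec.
rewrite !mul0mx !addr0 => e.
by apply/eqP; rewrite subr_eq addrAC eq_sym subr_eq e.
Qed.

(* A coboundary [bracket _ B] integrates to the inner derivation, so [psi] is
   determined on all products. *)
Lemma psi_inner B : (forall i, tangent_mx i = bracket (mult_mx i) B) ->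
  forall f, f \in J -> psi f = 0.
Proof.
move=> inner.
have key f u : psi (f * sec u) = ev (f * sec u) *m B - ev (f * sec (u *m B)).
  elim/mpoly_ind_gen: f u => [u|c f g hf hg u|i f hf u].
  - by rewrite !mul1r psi_sec !ev_sec subrr.
  - rewrite !mulrDl -!scalerAl psi_lin !ev_lin hf hg mulmxDl -scalemxAl scalerBr.
    by rewrite opprD addrACA.
  - rewrite -!mulrA psi_mulX !ev_mul hf inner /bracket mulmxBr mulmxBl !mulmxA.
    by rewrite addrA subrK.
move=> f fJ; have := key f (ev 1).
have r1 : res 1 \in J := resP 1.
(* The section need not fix 1; the error [f * res 1] is a product of two elements of [J], killed by
   [psi_ann]. *)
have -> : f * sec (ev 1) = f - f * res 1 by rewrite /res mulrBr mulr1 opprB addrC subrK.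
have fz g : ev (f * g) = 0 by apply/ev_eq0; rewrite mulrC; apply: idealZ.
have -> : ev (f - f * res 1) = 0.
  by rewrite -[f in f - _]mulr1 -mulrBr fz.
rewrite fz mul0mx subr0 => e.
by have := psiD (f - f * res 1) (f * res 1); rewrite subrK e psi_ann // addr0.
Qed.

Lemma psi_eq0 : (forall f, f \in J -> psi f = 0) -> phi = 0.
Proof.
move=> h; apply: hom_eqP => -[f fJ]; apply: vr_inj.
by rewrite -(psi_ideal fJ) h // [submod_val 0 _]/(0 : quotmod J) vr0.
Qed.

End OneHom.

Definition i0 : 'I_3 := @Ordinal 3 0 isT.
Definition i1 : 'I_3 := @Ordinal 3 1 isT.
Definition i2 : 'I_3 := @Ordinal 3 2 isT.

Lemma ord3_ind (Q : 'I_3 -> Prop) : Q i0 -> Q i1 -> Q i2 -> forall i, Q i.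
Proof.
by move=> q0 q1 q2 [[|[|[|//]]] lt_i]; rewrite (bool_irrelevance lt_i isT).
Qed.

Local Notation X := (mult_mx i0).
Local Notation Y := (mult_mx i1).
Local Notation Z := (mult_mx i2).

Lemma mult_mx_cyclic : cyclic_vector X Y Z (ev 1).
Proof. by move=> W W1 WX WY WZ; apply: ev1_cyclic => // i; elim/ord3_ind: i. Qed.

Definition tangent_of (phi : restr F (Defs.hom (submod J) (quotmod J))) : triple F l :=
  ((tangent_mx phi i0, tangent_mx phi i1), tangent_mx phi i2).

Lemma tangent_of_linear : linear tangent_of.
Proof.
move=> c phi phi'; have lin i : tangent_mx (c *: phi + phi' : restr F _) i =
    c *: tangent_mx phi i + tangent_mx phi' i.
  have psi_hom f : psi (c *: phi + phi' : restr F _) f = c *: psi phi f + psi phi' f.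
    by rewrite /psi -vr_lin.
  by apply/matrixP => a b; rewrite !mxE psi_hom !mxE.
by rewrite /tangent_of !lin.
Qed.

Lemma tangent_of_mem phi : tangent_of phi \in tangent X Y Z.
Proof. by apply/tangentP; split; apply: tangent_mx_comm. Qed.

Definition inner (B : 'M[F]_l) : triple F l := ((bracket X B, bracket Y B), bracket Z B).

Lemma inner_linear : linear inner.
Proof. by move=> c A B; rewrite /inner !bracket_linear. Qed.

Lemma tangent_of_inner phi B : tangent_of phi = inner B -> phi = 0.
Proof.
move=> [e0 e1 e2]; apply: psi_eq0; apply: (@psi_inner _ B) => i.
by elim/ord3_ind: i.
Qed.

Lemma jacobi_bracket (S T B : 'M[F]_l) : S *m T = T *m S ->
  bracket S (bracket T B) = bracket T (bracket S B).
Proof.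
move=> ST; have e1 : S *m (T *m B) = T *m (S *m B) by rewrite !mulmxA ST.
have e2 : B *m T *m S = B *m S *m T by rewrite -!mulmxA ST.
rewrite /bracket !mulmxBr !mulmxBl e1 e2 !mulmxA !opprB addrACA [RHS]addrACA.
by congr (_ + _); rewrite addrC.
Qed.

Lemma inner_mem B : inner B \in tangent X Y Z.
Proof. by apply/tangentP; split; apply: jacobi_bracket; apply: mult_mx_comm. Qed.

(** The kernel of such a [B] is stable and contains the cyclic vector. So the commutant has
    dimension at most [l], and the image of [inner] at least l^2 - l. *)
Lemma commutant_eq0 B : inner B = 0 -> ev 1 *m B = 0 -> B = 0.
Proof.
move=> [b0 b1 b2] B1; suff /sub_kermxP : (1%:M <= kermx B)%MS by rewrite mul1mx.
have st T : bracket T B = 0 -> (kermx B *m T <= kermx B)%MS.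
  move/eqP; rewrite subr_eq0 => /eqP TB.
  by apply/sub_kermxP; rewrite -mulmxA TB mulmxA mulmx_ker mul0mx.
by apply: mult_mx_cyclic; [apply/sub_kermxP | apply: st..].
Qed.

(** The images of [tangent_of] and [inner] meet only in 0 by [tangent_of_inner], so their dimensions
    add up inside the tangent space. *)
Lemma tangent_dim_exists : exists t,
  is_dim (restr F (Defs.hom (submod J) (quotmod J))) t /\
  (t + l ^ 2 <= \dim (tangent X Y Z) + l)%N.
Proof.
have inj : injective tangent_of.
  move=> phi phi' e; apply/eqP; rewrite -subr_eq0; apply/eqP.
  have inner0 : inner 0 = 0.
    by have := inner_linear (-1) 0 0; rewrite scaler0 addr0 scaleN1r addNr.
  apply: (@tangent_of_inner _ 0); rewrite inner0.
  by have := tangent_of_linear (-1) phi' phi; rewrite e !scaleN1r addNr [- phi' + _]addrC.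
have [U [Udim UE]] := is_dim_inj tangent_of_linear inj.
exists (\dim U); split=> //.
pose li := GRing.isLinear.Build F 'M[F]_l (triple F l) _ inner inner_linear.
pose g : {linear 'M[F]_l -> triple F l} := HB.pack inner li.
pose B := limg (linfun g).
have dimB : (l ^ 2 <= \dim B + l)%N.
  have := limg_ker_dim (linfun g) fullv; rewrite dimvf capfv -/B => dimE.
  have -> : (l ^ 2 = dim 'M[F]_l)%N by rewrite [RHS](dim_matrix F l l); lia.
  rewrite -dimE addnC leq_add2l.
  have dim_rV : \dim {: 'rV[F]_l} = l by rewrite dimvf [LHS]mul1n.
  rewrite -[X in (_ <= X)%N]dim_rV; apply: (@dim_inj_le _ _ _ (mulmx (ev 1))).
  - by move=> c A A'; rewrite mulmxDr -scalemxAr.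
  - by move=> A; rewrite memv_ker lfunE => /eqP; apply: commutant_eq0.
  - by move=> A _; rewrite memvf.
have UB0 : (U :&: B = 0)%VS.
  apply/eqP; rewrite -subv0; apply/subvP => w; rewrite memv_cap memv0.
  move=> /andP [/UE [phi ->] /memv_imgP [A _]]; rewrite lfunE => /= e.
  have /= -> := tangent_of_inner e.
  by have := tangent_of_linear (-1) 0 0; rewrite scaler0 addr0 scaleN1r addNr => ->.
have sT : (U + B <= tangent X Y Z)%VS.
  rewrite subv_add; apply/andP; split; apply/subvP => w.
    by move=> /UE [phi ->]; apply: tangent_of_mem.
  by move=> /memv_imgP [A _ ->]; rewrite lfunE; apply: inner_mem.
have := dimvS sT; rewrite dimv_disjoint_sum // => leT.
by apply: leq_trans (leq_add (leqnn _) dimB) _; rewrite addnA leq_add2r.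
Qed.

End TangentSpace.

Lemma is_dim_coords (F : numClosedFieldType) l (J : ideal {mpoly F[3]}) :
  is_dim (restr F (quotmod J)) l -> exists vr : quotmod J -> 'rV[F]_l,
  [/\ forall (c : F) x y, vr ((c%:A : {mpoly F[3]}) *: x + y) = c *: vr x + vr y,
      injective vr & forall u, exists x, vr x = u].
Proof.
move=> [[vr vr_lin [g vrK gK]]]; exists vr; split.
- exact: vr_lin.
- exact: can_inj vrK.
- by move=> u; exists (g u).
Qed.

(** * Powers of maximal ideals *)

Section PowersOfIdeals.
Variable A : comNzRingType.

Lemma gen_sub (S : set A) (J : ideal A) : (forall s, S s -> s \in J) ->
  forall f, f \in gen S -> f \in J.
Proof. by move=> SJ f /asboolP; apply. Qed.

Lemma mem_gen (S : set A) s : S s -> s \in gen S.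
Proof. by move=> Ss; apply/asboolP => J; apply. Qed.

Lemma colon_closed (J : ideal A) (a : A) :
  submod_closed (fun f : A^o => a * (f : A) \in J : bool).
Proof.
split=> [|b f g fJ gJ].
  by suff : a * 0 \in J by []; rewrite mulr0; apply: rpred0.
suff : a * (b * (f : A) + (g : A)) \in J by [].
by rewrite mulrDr mulrCA; apply: rpredD gJ; apply: idealZ.
Qed.

Definition colon J a : ideal A := Submodule (colon_closed J a).

Lemma mem_colon J a f : (f \in colon J a) = (a * f \in J).
Proof. by []. Qed.

Section Generators.
Variables (n : nat) (g : 'I_n -> A).
Let I : ideal A := gen [set f | exists i : 'I_n, f = g i].

Let mono_mul i m : g i * mmap1 g m = mmap1 g (U_(i) + m)%MM.
Proof.
by rewrite commr_mmap1_M ?mmap1U // => *; apply: mulrC.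
Qed.

(** Colon ideals separate the factors of a product: fixing one factor, it suffices to test the other
    on generators. *)
Lemma ideal_exp_sub k (J : ideal A) : (forall m, mdeg m = k -> mmap1 g m \in J) ->
  forall f, f \in ideal_exp I k -> f \in J.
Proof.
elim: k J => [|k IHk] J gJ.
  apply: gen_sub => _ ->; rewrite -(mmap11 g); apply: gJ; exact: mdeg0.
apply: gen_sub => _ [a [b [aI bI ->]]].
rewrite mulrC -mem_colon; apply: gen_sub aI => _ [i ->].
rewrite mem_colon mulrC -mem_colon; apply: IHk bI => m mk.
by rewrite mem_colon mono_mul; apply: gJ; rewrite mdegD mdeg1 mk.
Qed.

Lemma mem_ideal_exp k m : (k <= mdeg m)%N -> mmap1 g m \in ideal_exp I k.
Proof.
elim: k m => [|k IHk] m.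
  by move=> _; rewrite -[mmap1 g m]mulr1; apply/idealZ/mem_gen.
move=> lt_km; have : (0 < mdeg m)%N by apply: leq_trans lt_km.
rewrite lt0n mdeg_eq0 => m0.
have [i mi] : exists i, (0 < m i)%N.
  apply/not_existsP => m_0; case/eqP: m0; apply/mnmP => i; rewrite mnm0E.
  by apply/eqP; rewrite -leqn0 leqNgt; apply/negP/m_0.
have mE : m = (U_(i) + (m - U_(i)))%MM.
  rewrite addmC submK //; apply/mnm_lepP => j; rewrite mnm1E.
  by case: eqP => // <-.
rewrite mE -mono_mul; apply: mem_gen; exists (g i), (mmap1 g (m - U_(i))%MM); split => //.
  by apply: mem_gen; exists i.
by apply: IHk; move: lt_km; rewrite {1}mE mdegD mdeg1.
Qed.

End Generators.
End PowersOfIdeals.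

Section Monomials.

Definition monos d : seq 'X_{1..3} :=
  [seq s2m t | t : d.-tuple 'I_3 <- enum (basis 3 d)].

Fixpoint low_monos k : seq 'X_{1..3} := if k is k'.+1 then monos k' ++ low_monos k' else [::].

Lemma mem_monos d m : (m \in monos d) = (mdeg m == d).
Proof. by rewrite basis_cover. Qed.

Lemma size_monos d : size (monos d) = 'C(d.+2, 2).
Proof. by rewrite /monos size_basis addn2 -[RHS]bin_sub // !subSS subn0. Qed.

Lemma uniq_monos d : uniq (monos d).
Proof. exact: uniq_basis. Qed.

Lemma mem_low_monos k m : (m \in low_monos k) = (mdeg m < k)%N.
Proof.
by elim: k => //= k IHk; rewrite mem_cat mem_monos IHk [RHS]ltnS [RHS]leq_eqVlt.
Qed.

Lemma size_low_monos k : size (low_monos k) = tet k.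
Proof. by elim: k => //= k IHk; rewrite size_cat size_monos IHk tetS. Qed.

Lemma uniq_low_monos k : uniq (low_monos k).
Proof.
elim: k => //= k IHk; rewrite cat_uniq uniq_monos IHk andbT /=.
apply/hasPn => m; rewrite mem_low_monos mem_monos => lt_mk.
by rewrite (ltn_eqF lt_mk).
Qed.

End Monomials.

Section FatPoint.
Variables (F : numClosedFieldType) (k : nat).
Local Notation P := {mpoly F[3]}.
Local Notation fat := (ideal_exp (origin_ideal F 3) k).

Lemma low_closed : submod_closed
  (fun f : P^o => `[< forall m, (mdeg m < k)%N -> (f : P)@_m = 0 >]).
Proof.
split=> [|a f g /asboolP f0 /asboolP g0]; apply/asboolP => m lt_mk.
  exact: mcoeff0.
rewrite mcoeffD g0 // addr0 -[a *: f]/(a * (f : P)) mcoeffM big1 // => -[/= m1 m2] /eqP mE.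
rewrite f0 ?mulr0 //; apply: leq_ltn_trans lt_mk.
apply: leq_trans (leq_addl (mdeg m1) _) _.
by have /(congr1 (@mdeg 3)) := mE; rewrite mdegD => /esym/eq_leq.
Qed.

Lemma mem_fat f : f \in fat <-> forall m, (mdeg m < k)%N -> f@_m = 0.
Proof.
split=> [|f0].
  move=> /(@ideal_exp_sub _ 3 (fun i => 'X_i) k (Submodule low_closed)) h.
  apply/asboolP/h => m mk; rewrite mmap1_id; apply/asboolP => m' lt_m'k.
  by rewrite mcoeffX; case: eqP => // mm'; move: lt_m'k; rewrite -mm' mk ltnn.
rewrite [f]mpolyE big_seq; apply: rpred_sum => m; rewrite mcoeff_msupp => fm.
rewrite -mul_mpolyC; apply: idealZ; rewrite -mmap1_id; apply: mem_ideal_exp.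
by rewrite leqNgt; apply: contraNN fm => /f0 ->.
Qed.

Definition low_coef (f : P) : 'rV[F]_(tet k) := \row_i f@_(nth 0%MM (low_monos k) i).

Lemma low_coef_lin c f g : low_coef (c *: f + g) = c *: low_coef f + low_coef g.
Proof. by apply/rowP => i; rewrite !mxE mcoeffD mcoeffZ. Qed.

Lemma low_coef_eq0 f : low_coef f = 0 <-> f \in fat.
Proof.
rewrite mem_fat; split=> [/rowP f0 m|f0].
  rewrite -mem_low_monos => mk.
  have lt_i : (index m (low_monos k) < tet k)%N by rewrite -size_low_monos index_mem.
  by have := f0 (Ordinal lt_i); rewrite !mxE /= nth_index.
by apply/rowP => i; rewrite !mxE f0 // -mem_low_monos mem_nth // size_low_monos.
Qed.

Lemma low_coef_surj u : exists f, low_coef f = u.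
Proof.
exists (\sum_(i < tet k) u 0 i *: 'X_[nth 0%MM (low_monos k) i]); apply/rowP => j.
rewrite mxE raddf_sum (bigD1 j) //= mcoeffZ mcoeffX eqxx mulr1 big1 ?addr0 // => i ne_ij.
by rewrite mcoeffZ mcoeffX nth_uniq ?size_low_monos ?uniq_low_monos // (inj_eq val_inj) (negPf ne_ij) mulr0.
Qed.

End FatPoint.

Lemma is_dim_quot (F : numClosedFieldType) l (J : ideal {mpoly F[3]})
    (e : {mpoly F[3]} -> 'rV[F]_l) :
  (forall c f g, e (c *: f + g) = c *: e f + e g) ->
  (forall f, e f = 0 <-> f \in J) -> (forall u, exists f, e f = u) ->
  is_dim (restr F (quotmod J)) l.
Proof.
move=> elin e0 esurj.
pose lift (x : quotmod J) := projT1 (cid (qpi_surj x)).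
have liftK x : qpi J (lift x) = x by rewrite /lift; case: cid.
have eB f g : e (f - g) = e f - e g by rewrite addrC -scaleN1r elin scaleN1r addrC.
have e_lift f : e (lift (qpi J f)) = e f.
  apply/eqP; rewrite -subr_eq0 -eB; apply/eqP/e0/qpi_eq0.
  by rewrite qpiB liftK subrr.
constructor; exists (fun x : restr F (quotmod J) => e (lift x)).
  move=> c x y; rewrite -elin -[RHS]e_lift; congr (e (lift _)).
  by rewrite -mulr_algl qpi_is_linear !liftK.
exists (fun u => qpi J (projT1 (cid (esurj u)))) => [x|u].
  case: cid => f /= fx; rewrite -[RHS]liftK; apply/eqP; rewrite -subr_eq0; apply/eqP.
  have : e (f - lift x) = 0 by rewrite eB fx subrr.
  by move=> /e0 /qpi_eq0; rewrite qpiB.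
by rewrite e_lift; case: cid.
Qed.

Lemma fat_degree (F : numClosedFieldType) k :
  is_dim (restr F (quotmod (ideal_exp (origin_ideal F 3) k))) (tet k).
Proof.
exact: is_dim_quot (@low_coef_lin F k) (@low_coef_eq0 F k) (@low_coef_surj F k).
Qed.

(** * Tangent vectors at a power of the maximal ideal *)

Section FatTangent.
Variables (F : numClosedFieldType) (k' : nat).
Let k := k'.+1.
Local Notation P := {mpoly F[3]}.
Local Notation fat := (ideal_exp (origin_ideal F 3) k).

Lemma mul_low (b h : P) d : b@_0 = 0 -> (forall m, (mdeg m < d)%N -> h@_m = 0) ->
  forall m, (mdeg m < d.+1)%N -> (b * h)@_m = 0.
Proof.
move=> b0 h0 m lt_md; rewrite mcoeffM big1 // => -[/= m1 m2] /eqP mE.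
case: (eqVneq (m1 : 'X_{1..3}) 0%MM) => [->|m1_0]; first by rewrite b0 mul0r.
rewrite h0 ?mulr0 //; rewrite -ltnS; apply: leq_trans lt_md; rewrite ltnS.
have /(congr1 (@mdeg 3)) := mE; rewrite mdegD => /esym/eq_leq; apply: leq_trans.
by rewrite -add1n leq_add2r lt0n mdeg_eq0.
Qed.

(* A matrix G, from forms of degree [k] to forms of degree [k'], applied to the
   component of degree [k] of [f]. *)
Definition sym_map (G : 'M[F]_(size (monos k), size (monos k'))) (f : P) : P :=
  \sum_(j < size (monos k')) (\sum_(i < size (monos k)) f@_(nth 0%MM (monos k) i) * G i j) *: 'X_[nth 0%MM (monos k') j].

Lemma mdeg_nth_monos d i : (i < size (monos d))%N -> mdeg (nth 0%MM (monos d) i) = d.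
Proof. by move=> lt_i; apply/eqP; rewrite -mem_monos mem_nth. Qed.

Lemma sym_map_low G f m : (mdeg m < k')%N -> (sym_map G f)@_m = 0.
Proof.
move=> lt_mk; rewrite raddf_sum big1 //= => j _; rewrite mcoeffZ mcoeffX.
case: eqP => [mE|_]; last by rewrite mulr0.
by move: lt_mk; rewrite -mE mdeg_nth_monos // ltnn.
Qed.

Lemma sym_map_mul G a f g : f \in fat ->
  sym_map G (a * f + g) = a@_0 *: sym_map G f + sym_map G g.
Proof.
move=> /mem_fat f0; rewrite /sym_map scaler_sumr -big_split; apply: eq_bigr => j _ /=.
rewrite scalerA -scalerDl; congr (_ *: _); rewrite mulr_sumr -big_split.
apply: eq_bigr => i _ /=; rewrite mcoeffD mulrDl; congr (_ + _).
rewrite mulrA; congr (_ * _); set m := nth _ _ _.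
rewrite -[a in LHS](subrK (a@_0)%:MP) mulrDl mcoeffD mcoeffCM.
rewrite (@mul_low _ _ k) ?add0r // ?mcoeffB ?mcoeffC ?eqxx ?mulr1 ?subrr //.
by rewrite ltnS mdeg_nth_monos.
Qed.

(** A polynomial acts through its constant term both on the degree [k] part of an element of m^k and
    on m^(k-1) modulo m^k, so any linear map between the forms is linear over the polynomials. *)
Lemma sym_hom_linear G : linear (fun x : submod fat => qpi fat (sym_map G (submod_val x))).
Proof.
move=> a x y; rewrite [submod_val _]/(a * submod_val x + submod_val y).
rewrite sym_map_mul ?submod_valP // qpiD -qpiM; congr (_ + _).
apply/eqP; rewrite -subr_eq0 -qpiB; apply/eqP/qpi_eq0/mem_fat => m lt_mk.
rewrite -mul_mpolyC -mulrBl; apply: (@mul_low _ _ k') => // [|m']; last exact: sym_map_low.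
by rewrite mcoeffB mcoeffC eqxx mulr1 subrr.
Qed.

Definition sym_hom G : restr F (Defs.hom (submod fat) (quotmod fat)) := mk_hom (sym_hom_linear G).

Lemma sym_map_linear c G G' f : sym_map (c *: G + G') f = c *: sym_map G f + sym_map G' f.
Proof.
rewrite /sym_map scaler_sumr -big_split; apply: eq_bigr => j _ /=.
rewrite scalerA -scalerDl; congr (_ *: _); rewrite mulr_sumr -big_split.
by apply: eq_bigr => i _ /=; rewrite !mxE mulrDr mulrCA.
Qed.

Lemma sym_hom_is_linear : linear sym_hom.
Proof.
move=> c G G'; apply: hom_eqP => x.
rewrite [RHS]/((c%:A : P) *: qpi fat (sym_map G (submod_val x)) +
  qpi fat (sym_map G' (submod_val x))).
rewrite [LHS]/(qpi fat (sym_map (c *: G + G') (submod_val x))) sym_map_linear.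
by rewrite -[c *: sym_map _ _]mulr_algl; apply: qpi_is_linear.
Qed.

Lemma sym_hom_inj : injective sym_hom.
Proof.
move=> G G' e; apply/matrixP => i j.
pose m := nth 0%MM (monos k) i; have mk : mdeg m = k by apply: mdeg_nth_monos.
have mf : ('X_[m] : P) \in fat.
  by apply/mem_fat => m' lt_m'k; rewrite mcoeffX; case: eqP => // mm'; move: lt_m'k; rewrite -mm' mk ltnn.
have := congr1 (fun phi : Defs.hom (submod fat) (quotmod fat) => submod_val phi (Submod mf)) e.
rewrite /= => /eqP; rewrite -subr_eq0 -qpiB => /eqP/qpi_eq0 diff.
have := iffLR (@mem_fat F k _) diff; move=> /(_ (nth 0%MM (monos k') j)); rewrite mdeg_nth_monos // => /(_ (leqnn _)) /eqP.
have coefE H : (sym_map H 'X_[m])@_(nth 0%MM (monos k') j) = H i j.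
  rewrite raddf_sum (bigD1 j) //= mcoeffZ mcoeffX eqxx mulr1 [X in _ + X]big1 ?addr0; last first.
    move=> j' ne_j; rewrite mcoeffZ mcoeffX nth_uniq ?uniq_monos //.
    by rewrite (inj_eq val_inj) (negPf ne_j) mulr0.
  rewrite (bigD1 i) //= mcoeffX eqxx mul1r big1 ?addr0 // => i' ne_i.
  rewrite mcoeffX nth_uniq ?uniq_monos // (inj_eq val_inj) eq_sym (negPf ne_i).
  by rewrite mul0r.
by rewrite mcoeffB !coefE subr_eq0 => /eqP.
Qed.

Lemma fat_tangent_ge t : is_dim (restr F (Defs.hom (submod fat) (quotmod fat))) t ->
  (maxT (tet k) <= t)%N.
Proof.
move=> dim_t; have := is_dim_ge dim_t sym_hom_is_linear sym_hom_inj.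
apply: leq_trans; rewrite maxT_tet.
by rewrite -[X in (_ <= X)%N]/(size (monos k) * size (monos k'))%N !size_monos.
Qed.

End FatTangent.

(** * The upper bound for ideals, its equality case and uniqueness *)

Section Upper.
Variables (F : numClosedFieldType) (l : nat) (J : ideal {mpoly F[3]}).
Local Notation P := {mpoly F[3]}.
Hypothesis degJ : is_dim (restr F (quotmod J)) l.

Lemma tangent_bound : exists2 t,
  is_dim (restr F (Defs.hom (submod J) (quotmod J))) t & (t <= maxT l)%N.
Proof.
have [vr [vr_lin vr_inj vr_surj]] := is_dim_coords degJ.
have [t [dim_t le_t]] := tangent_dim_exists vr_lin vr_inj vr_surj.
exists t => //.
have [bound _] := global_bound (mult_mx_comm vr_lin vr_inj vr_surj i0 i1)
  (mult_mx_comm vr_lin vr_inj vr_surj i0 i2) (mult_mx_comm vr_lin vr_inj vr_surj i1 i2)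
  (@mult_mx_cyclic _ _ _ _ vr_lin vr_inj vr_surj).
by have := leq_trans le_t bound; rewrite addnC leq_add2l.
Qed.

(** [p] collects the eigenvalues of the three multiplications, that is, the only point of support.
    Monomials of degree [k] in the translated operators vanish, in particular on the class of 1. *)
Lemma tangent_max k : (0 < k)%N -> l = tet k ->
  is_dim (restr F (Defs.hom (submod J) (quotmod J))) (maxT l) ->
  exists p : 'I_3 -> F, forall m, mdeg m = k ->
    mmap1 (fun i => 'X_i - (p i)%:MP) m \in J.
Proof.
move=> k_gt0 lk dim_max.
have [vr [vr_lin vr_inj vr_surj]] := is_dim_coords degJ.
have [t [dim_t le_t]] := tangent_dim_exists vr_lin vr_inj vr_surj.
have tE : t = maxT l := is_dim_uniq dim_t dim_max.
have [bound eqcase] := global_bound (mult_mx_comm vr_lin vr_inj vr_surj i0 i1)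
  (mult_mx_comm vr_lin vr_inj vr_surj i0 i2) (mult_mx_comm vr_lin vr_inj vr_surj i1 i2)
  (@mult_mx_cyclic _ _ _ _ vr_lin vr_inj vr_surj).
have [|p [q [r zero]]] := eqcase k k_gt0 lk.
  by apply/eqP; rewrite eqn_leq bound /= addnC -tE le_t.
pose c (i : 'I_3) : F := [:: p; q; r]`_i; exists c => m mk.
apply/(ev_eq0 vr_lin vr_inj).
pose M i := mult_mx vr_surj i; pose g i : P := 'X_i - (c i)%:MP.
have ev_g i e f : ev vr (g i ^+ e * f) = ev vr f *m (M i - (c i)%:M) ^+ e.
  elim: e f => [|e IHe] f; first by rewrite !expr0 mul1r mulmx1.
  rewrite exprSr -mulrA IHe expmxS mulmxA; congr (_ *m _).
  rewrite mulrBl mul_mpolyC addrC -scaleNr (ev_lin vr_lin) (ev_mul vr_lin vr_inj vr_surj).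
  by rewrite mulmxBr mul_mx_scalar addrC scaleNr.
have mm : mmap1 g m = g i2 ^+ m i2 * (g i1 ^+ m i1 * (g i0 ^+ m i0 * 1)).
  rewrite /mmap1 !big_ord_recl big_ord0.
  have -> : lift ord0 ord0 = i1 :> 'I_3 by apply/val_inj.
  have -> : lift ord0 (lift ord0 ord0) = i2 :> 'I_3 by apply/val_inj.
  have -> : ord0 = i0 :> 'I_3 by apply/val_inj.
  by rewrite !mulr1 mulrC (mulrC (g i1 ^+ _)) -mulrA.
rewrite mm !ev_g -(mulmxA (ev vr 1)) -(mulmxA (ev vr 1)) zero ?mulmx0 //.
rewrite -mk mdegE !big_ord_recl big_ord0 addn0 addnA.
by congr (_ + _ + _)%N; congr (m _); apply/val_inj.
Qed.

End Upper.

(** By the inclusion of kernels [e1] is [e2] followed by a square matrix, which is invertible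
    because [e1] is surjective. This compares ideals of equal finite colength in an
    infinite-dimensional ring. *)
Lemma surj_ker_eq (F : fieldType) (V : lmodType F) l (e1 e2 : V -> 'rV[F]_l) :
  linear e1 -> linear e2 -> (forall u, exists f, e1 f = u) ->
  (forall u, exists f, e2 f = u) -> (forall f, e2 f = 0 -> e1 f = 0) ->
  forall f, e1 f = 0 -> e2 f = 0.
Proof.
move=> lin1 lin2 surj1 surj2 e21.
pose b (j : 'I_l) := projT1 (cid (surj2 (delta_mx 0 j))).
have bE j : e2 (b j) = delta_mx 0 j by rewrite /b; case: cid.
pose s (u : 'rV[F]_l) := \sum_j u 0 j *: b j.
have l0 (e : V -> 'rV[F]_l) : linear e -> e 0 = 0.
  by move=> elin; have := elin (-1) 0 0; rewrite scaler0 addr0 scaleN1r addNr.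
have ls (e : V -> 'rV[F]_l) u : linear e -> e (s u) = u *m \matrix_(j, k) e (b j) 0 k.
  move=> elin; rewrite mulmx_sum_row /s.
  apply: (big_rec2 (fun f w => e f = w)) => [|j w f _ <-]; first exact: l0.
  by rewrite elin; congr (_ *: _ + _); apply/rowP => k; rewrite !mxE.
pose M := \matrix_(j, k) e1 (b j) 0 k.
have e1E f : e1 f = e2 f *m M.
  rewrite -ls //; apply/eqP; rewrite -subr_eq0; apply/eqP.
  have eB (e : V -> 'rV[F]_l) u v : linear e -> e (u - v) = e u - e v.
    by move=> elin; rewrite addrC -scaleN1r elin scaleN1r addrC.
  rewrite -eB //; apply: e21; rewrite eB // ls //.
  have -> : \matrix_(j, k) e2 (b j) 0 k = 1%:M.
    by apply/matrixP => j k; rewrite mxE bE !mxE eqxx eq_sym.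
  by rewrite mulmx1 subrr.
have uM : row_free M.
  rewrite row_free_unit -row_full_unit -sub1mx; apply/rV_subP => u _.
  by have [f <-] := surj1 u; rewrite e1E submxMl.
by move=> f /eqP; rewrite e1E mulmx_free_eq0 // => /eqP.
Qed.

Section Translation.
Variables (F : numClosedFieldType) (p : 'I_3 -> F).
Local Notation P := {mpoly F[3]}.
Let g i : P := 'X_i - (p i)%:MP.

Definition translate (f : P) : P := f \mPo [tuple g i | i < 3].

Lemma translateE f : translate f = \sum_(m <- msupp f) f@_m *: mmap1 g m.
Proof.
rewrite /translate comp_mpolyE; apply: eq_bigr => m _; congr (_ *: _).
by apply: eq_bigr => i _; rewrite tnth_mktuple.
Qed.

Lemma translate_linear : linear translate.
Proof. by move=> c f h; rewrite /translate comp_mpolyD comp_mpolyZ. Qed.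

Lemma translate_surj f : exists h, translate h = f.
Proof.
elim/mpoly_ind_gen: f => [|c f f' [h <-] [h' <-]|i f [h <-]].
- by exists 1; rewrite /translate comp_mpoly1.
- by exists (c *: h + h'); rewrite translate_linear.
exists (('X_i + (p i)%:MP) * h); rewrite /translate rmorphM /= comp_mpolyD comp_mpolyC.
by rewrite comp_mpolyXU -tnth_nth tnth_mktuple /g subrK.
Qed.

End Translation.

Section Uniqueness.
Variables (F : numClosedFieldType) (k : nat) (J : ideal {mpoly F[3]}) (p : 'I_3 -> F).
Hypothesis degJ : is_dim (restr F (quotmod J)) (tet k).
Local Notation g := (fun i : 'I_3 => 'X_i - (p i)%:MP : {mpoly F[3]}).
Hypothesis monoJ : forall m, mdeg m = k -> mmap1 g m \in J.

Lemma point_power_sub f : f \in ideal_exp (point_ideal p) k -> f \in J.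
Proof. exact: ideal_exp_sub monoJ f. Qed.

Lemma eq_point_power : J =i ideal_exp (point_ideal p) k.
Proof.
move=> f; apply/idP/idP; last exact: point_power_sub.
have [vr [vr_lin vr_inj vr_surj]] := is_dim_coords degJ.
have [h <-] := translate_surj p f => hJ.
have low_lin : linear (@low_coef F k) by exact: low_coef_lin.
have ev_surj' u : exists h, (ev vr \o translate p) h = u.
  have [f' <-] := ev_surj vr_surj u; have [h' <-] := translate_surj p f'.
  by exists h'.
have transfer h' : h' \in ideal_exp (origin_ideal F 3) k ->
    translate p h' \in ideal_exp (point_ideal p) k.
  move=> /mem_fat h0; rewrite translateE big_seq; apply: rpred_sum => m.
  rewrite mcoeff_msupp => hm; rewrite -mul_mpolyC; apply: idealZ; apply: mem_ideal_exp.
  by rewrite leqNgt; apply: contraNN hm => /h0 ->.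
apply/transfer/low_coef_eq0.
(* Pulled back along [translate p], both maps are surjections onto a space of dimension [tet k]: the
   class modulo [J], and the coefficients of degree below [k]. *)
apply: (@surj_ker_eq _ _ _ (ev vr \o translate p) (@low_coef F k)) => //.
- by move=> c u v /=; rewrite translate_linear (ev_lin vr_lin).
- exact: low_coef_surj.
- by move=> h' /low_coef_eq0 /transfer /point_power_sub /(ev_eq0 vr_lin vr_inj).
- by apply/(ev_eq0 vr_lin vr_inj).
Qed.

End Uniqueness.

(* [m^k] is most singular, and it is the only such point up to translation of
   the affine space: translating by p carries m^k to the k-th power of the
   maximal ideal of p, which has the same degree and tangent dimension. *)
Theorem theoremA (R : realType) (k : nat) (hk : (0 < k)%N) :
  most_singular 'C(k + 2, 3) (ideal_exp (origin_ideal R[i] 3) k) /\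
  (forall J : ideal {mpoly R[i][3]},
     most_singular 'C(k + 2, 3) J ->
     exists p : 'I_3 -> R[i], J =i ideal_exp (point_ideal p) k).
Proof.
have tetE : 'C(k + 2, 3) = tet k by rewrite /tet addn2.
rewrite tetE.
have deg_fat : has_degree (ideal_exp (origin_ideal R[i] 3) k) (tet k) := fat_degree R[i] k.
have dim_fat : has_tangent_dim (ideal_exp (origin_ideal R[i] 3) k) (maxT (tet k)).
  have [t dim_t le_t] := tangent_bound deg_fat.
  suff -> : maxT (tet k) = t by [].
  apply/eqP; rewrite eqn_leq le_t andbT.
  by case: k hk dim_t {tetE deg_fat le_t} => // k' _; apply: fat_tangent_ge.
split.
  split=> //; exists (maxT (tet k)) => // J' deg_J'.
  exact: tangent_bound deg_J'.
move=> J [deg_J [t dim_t max_t]].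
have [t' dim_t' le_t'] := max_t _ deg_fat.
have [t'' dim_t'' le_t''] := tangent_bound deg_J.
(* The lower bound on [t] holds because m^k is one of the competitors of [J]. *)
have tE : t = maxT (tet k).
  apply/eqP; rewrite eqn_leq -{1}(is_dim_uniq dim_t'' dim_t) le_t'' /=.
  by rewrite -(is_dim_uniq dim_t' dim_fat).
rewrite tE in dim_t.
have [p monoJ] := tangent_max deg_J hk erefl dim_t.
by exists p; apply: eq_point_power deg_J monoJ.
Qed.
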